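(* Let $\ell\in\mathbb{N}$, $p>1$, and $1/p+1/q=1$. Let $$\mathfrak{g}_n^{(\ell,p)}:=\frac{\Gamma(n+1/q)}{\Gamma(n-\ell+1)}\quad\text{for all } n\in\mathbb{Z}$$ (with $1/\Gamma$ understood to vanish at non-positive integers). Then the sequence $\{\rho_n^{(\ell,p)}\}_{n\ge\ell}$ given by $$\rho_n^{(\ell,p)}:=\frac{-\Delta_p^{(\ell)}\mathfrak{g}_n^{(\ell,p)}}{\bigl(\mathfrak{g}_n^{(\ell,p)}\bigr)^{p-1}}=\left(\frac{1}{q}\right)_{\!\ell}^{\!p-1}\left[\frac{\Gamma(n-\ell+1)}{\Gamma(n+1/q)}\right]^{p-1}\sum_{j=0}^{\ell}(-1)^{j}\binom{\ell}{j}\left[\frac{\Gamma(n-\ell+j+1/q)}{\Gamma(n-\ell+j+1)}\right]^{p-1}$$ (the second equality being part of the assertion) is an optimal discrete $p$-Hardy--Rellich--Birman weight (of order $\ell$) satisfying $$\rho_{n}^{(\ell,p)}>\left(\frac{1}{q}\right)_{\!\ell}^{\!p}\frac{1}{n^{\ell p}}\quad\text{for all } n\ge\ell.$$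
   Context: $\mathbb{N}=\{1,2,\dots\}$. $(a)_\ell:=a(a+1)\cdots(a+\ell-1)$ is the Pochhammer symbol, and $(a)_\ell^{s}$ means $\bigl((a)_\ell\bigr)^s$. $C(\mathbb{Z})$ is the space of complex sequences indexed by $\mathbb{Z}$, and $C_0(\mathbb{Z})$ its subspace of finitely supported sequences. For $u\in C(\mathbb{Z})$ put $\nabla u_n=(\nabla u)_n:=u_n-u_{n-1}$ and $\mathrm{div}\,u_n=(\mathrm{div}\,u)_n:=u_{n+1}-u_n$, $n\in\mathbb{Z}$. For $m\in\mathbb{N}$, $H^m:=\{u\in C(\mathbb{Z}) : u_n=0 \text{ for all } n<m\}$ and $\mathcal{H}_0^m:=H^m\cap C_0(\mathbb{Z})$. For $\nu\in\mathbb{C}$ and $a>0$, $\nu^{\langle a\rangle}:=\nu|\nu|^{a-1}$ with $0^{\langle a\rangle}:=0$ (applied entrywise to sequences). The discrete $p$-Laplacian of order $\ell$ is $-\Delta_p^{(\ell)}u:=(-1)^\ell\,\mathrm{div}^\ell\bigl((\nabla^\ell u)^{\langle p-1\rangle}\bigr)$. A non-negative sequence $\rho=\{\rho_n\}_{n=\ell}^\infty$ is a discrete $p$-Hardy--Rellich--Birman weight if $$(\ast)\qquad\sum_{n=\ell}^{\infty}\bigl|\nabla^\ell u_n\bigr|^p\ge\sum_{n=\ell}^{\infty}\rho_n|u_n|^p$$ holds for all $u\in\mathcal{H}_0^\ell$. Such a weight $\rho$ is optimal if it has the following three properties: (i) Criticality: for any discrete $p$-Hardy--Rellich--Birman weight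 $\tilde\rho$ with $\tilde\rho_n\ge\rho_n$ for all $n\ge\ell$, it follows that $\tilde\rho=\rho$. (ii) Non-attainability: whenever equality in $(\ast)$ is attained for some $u\in H^\ell$ such that the right-hand side of $(\ast)$ is finite, then $u\equiv0$. (iii) Optimality near infinity: for any $m\ge\ell$ and $\varepsilon>0$ there exists $u\in\mathcal{H}_0^m$ such that $\sum_{n=\ell}^{\infty}|\nabla^\ell u_n|^p<(1+\varepsilon)\sum_{n=\ell}^{\infty}\rho_n|u_n|^p$. *)

(* Defs.v *)
From mathcomp Require Import all_boot all_order all_algebra.
From mathcomp Require Import all_classical all_reals all_analysis.
From mathcomp Require Import complex.

Set Implicit Arguments.
Unset Strict Implicit.
Unset Printing Implicit Defensive.

Import Order.TTheory GRing.Theory Num.Theory.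
Import numFieldNormedType.Exports.

Local Open Scope classical_set_scope.
Local Open Scope complex_scope.
Local Open Scope ring_scope.

Definition pochhammer (R : nzRingType) (a : R) (l : nat) : R :=
  \prod_(i < l) (a + i%:R).

(* Gamma on the real line: the Euler integral for x > 0, extended to x <= 0 by
   the functional equation Gamma (x + k) = (x)_k Gamma x, with k the least
   natural number such that x + k > 0. *)
Definition Gamma_integral (R : realType) (x : R) : R :=
  \int[@lebesgue_measure R]_(t in `]0%R, +oo[) (t `^ (x - 1) * expR (- t)).

Definition Gamma_shift (R : realType) (x : R) : nat :=
  if 0 < x then 0%N else (Num.truncn (- x)).+1.

(* At the poles 0, -1, -2, ... this is a division by zero; see rGamma. *)
Definition Gamma (R : realType) (x : R) : R :=
  let k := Gamma_shift x in
  Gamma_integral (x + k%:R) / pochhammer x k.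

(* 1 / Gamma, vanishing at 0, -1, -2, ... where (x)_k has a zero factor. *)
Definition rGamma (R : realType) (x : R) : R :=
  let k := Gamma_shift x in
  pochhammer x k / Gamma_integral (x + k%:R).

Lemma rGammaE (R : realType) (x : R) : rGamma x = (Gamma x)^-1.
Proof. by rewrite /rGamma /Gamma invfM invrK mulrC. Qed.

Lemma rGamma_nonpos (R : realType) (m : nat) : rGamma (- m%:R : R) = 0.
Proof.
rewrite /rGamma /Gamma_shift ltrNr oppr0 ltrn0 opprK natrK.
by rewrite /pochhammer big_ord_recr /= addNr mulr0 mul0r.
Qed.

Lemma Gamma_pos (R : realType) (x : R) : 0 < x -> Gamma x = Gamma_integral x.
Proof.
by move=> x0; rewrite /Gamma /Gamma_shift x0 /pochhammer big_ord0 addr0 divr1.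
Qed.

Section HardyRellichBirman.
Variable R : realType.
Implicit Types (u : int -> R[i]) (rho : nat -> R) (l m : nat) (p a : R).

Definition cabs (z : R[i]) : R := Normc.normc z.

Definition nabla u : int -> R[i] := fun n => u n - u (n - 1).

Definition dvg u : int -> R[i] := fun n => u (n + 1) - u n.

(* nu |nu| ^ (a - 1); the value at nu = 0 is 0 because of the first factor. *)
Definition spow a (nu : R[i]) : R[i] := nu * (cabs nu `^ (a - 1))%:C.

(* The operator - Delta_p^(l), sign included. *)
Definition neg_pLaplacian l p u : int -> R[i] :=
  fun n => (-1) ^+ l * iter l dvg (fun k => spow (p - 1) (iter l nabla u k)) n.

Definition Hspace m : set (int -> R[i]) :=
  [set u | forall n : int, n < m%:Z -> u n = 0].

Definition H0space m : set (int -> R[i]) :=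
  [set u | Hspace m u /\ finite_set [set n | u n != 0]].

Definition energy l p u : \bar R :=
  (\sum_(l <= n <oo) (cabs (iter l nabla u n%:Z) `^ p)%:E)%E.

Definition weighted_norm l p rho u : \bar R :=
  (\sum_(l <= n <oo) (rho n * cabs (u n%:Z) `^ p)%:E)%E.

(* Weights are indexed by nat; only the entries of index n >= l matter. *)
Definition HRB_weight l p rho : Prop :=
  (forall n, (l <= n)%N -> 0 <= rho n) /\
  (forall u, H0space l u -> (weighted_norm l p rho u <= energy l p u)%E).

Definition critical l p rho : Prop :=
  forall rho', HRB_weight l p rho' ->
    (forall n, (l <= n)%N -> rho n <= rho' n) ->
    forall n, (l <= n)%N -> rho' n = rho n.

Definition non_attainable l p rho : Prop :=
  forall u, Hspace l u -> (weighted_norm l p rho u < +oo)%E ->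
    energy l p u = weighted_norm l p rho u -> forall n, u n = 0.

Definition optimal_near_infinity l p rho : Prop :=
  forall m (eps : R), (l <= m)%N -> 0 < eps ->
    exists u, H0space m u /\
      (energy l p u < (1 + eps)%:E * weighted_norm l p rho u)%E.

Definition optimal_HRB_weight l p rho : Prop :=
  [/\ HRB_weight l p rho, critical l p rho, non_attainable l p rho
    & optimal_near_infinity l p rho].

Definition gseq l (q : R) (n : int) : R :=
  Gamma (n%:~R + q^-1) * rGamma (n%:~R - l%:R + 1).

Definition rho_explicit l p (q : R) (n : nat) : R :=
  pochhammer q^-1 l `^ (p - 1)
  * (Gamma (n%:R - l%:R + 1) / Gamma (n%:R + q^-1)) `^ (p - 1)
  * \sum_(0 <= j < l.+1) (-1) ^+ j * 'C(l, j)%:R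
      * (Gamma (n%:R - l%:R + j%:R + q^-1)
         / Gamma (n%:R - l%:R + j%:R + 1)) `^ (p - 1).

End HardyRellichBirman.

(* Main.v *)
(** Put s = 1/q = 1 - 1/p, re-index sequences by m = n - l, and write
    P x m = (x)_m / m!. The backward difference of P (x + 1) is P x, the
    sequence g of the theorem is a multiple of P (s + l), its l-th difference
    a multiple of P s, and rho = D^l f / P (s + l) ^ (p - 1) with
    f = (P s) ^ (p - 1) and D a = a m - a (m + 1).

    Lower bound. f is the product of 1 / P (s + 1), whose differences D^k are
    explicit, and of a completely monotone sequence kappa; by Leibniz
    D^l f m > kappa (m + l) D^l (1 / P (s + 1)) m, where all Gamma factors
    cancel. Complete monotonicity of kappa comes from that of the function
    x ((x / (x - 1/p)) ^ (p - 1) - 1) - s.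

    Inequality. Radon's inequality is a Picone inequality for the pair
    (u, P (x + 1)); summed by parts against D^j f >= 0 it gives
    sum (D^(j+1) f / P (s+j+1) ^ (p-1)) |u| ^ p <=
    sum (D^j f / P (s+j) ^ (p-1)) |nabla u| ^ p,
    and l such steps give the Hardy-Rellich-Birman inequality for all u, with
    boundary terms of the favourable sign. Equality forces u to be a multiple
    of P (s + l), whose weighted norm diverges like the harmonic series.

    Criticality and optimality. For the test sequence P (s - d + l) each step
    loses at most the factor 1 - (p d / s) ^ 2, whereas its energy is at most
    2 / (p d); so the total deficit tends to 0 with d while the energy tends to
    infinity. Multiplying by 'C(N - m, l + 1) / 'C(N, l + 1) makes the test
    sequence finitely supported, and Vandermonde's identity bounds the l-th
    differences uniformly in N by a multiple of P (s - d). *)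

Require Import Defs.
From mathcomp Require Import all_boot all_order all_algebra.
From mathcomp Require Import all_classical all_reals all_analysis.
From mathcomp Require Import measurable_realfun complex.
From mathcomp Require Import ring lra.

Set Implicit Arguments.
Unset Strict Implicit.
Unset Printing Implicit Defensive.

Import Order.TTheory GRing.Theory Num.Theory.
Import numFieldNormedType.Exports.

Local Open Scope complex_scope.
Local Open Scope ring_scope.

(** * Derivative rules on the real line *)

Section Derivatives.
Variable R : realType.
Implicit Types (f g : R -> R) (a c x : R).

Lemma is_derive1M f g x df dg : is_derive x 1 f df -> is_derive x 1 g dg ->
  is_derive x 1 (fun y => f y * g y) (df * g x + f x * dg).
Proof.
move=> hf hg; have -> : df * g x + f x * dg = f x *: dg + g x *: df.
  by rewrite /GRing.scale/= addrC (mulrC df).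
exact: (is_deriveM hf hg).
Qed.

Lemma is_derive1D f g x df dg : is_derive x 1 f df -> is_derive x 1 g dg ->
  is_derive x 1 (fun y => f y + g y) (df + dg).
Proof. by move=> hf hg; exact: is_deriveD. Qed.

Lemma is_derive1Zl f a x df : is_derive x 1 f df ->
  is_derive x 1 (fun y => a * f y) (a * df).
Proof.
move=> hf; rewrite -[a * df]add0r -(mul0r (f x)).
exact: (is_derive1M (f := cst a) (is_derive_cst a x 1) hf).
Qed.

Lemma is_derive1_addr a x : is_derive x 1 (fun y => y + a) 1.
Proof.
rewrite -[X in is_derive _ _ _ X]addr0.
exact: (is_derive1D (is_derive_id x 1) (is_derive_cst a x 1)).
Qed.

Lemma is_derive1_subr a x : is_derive x 1 (fun y => y - a) 1.
Proof. exact: is_derive1_addr. Qed.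

Lemma is_derive1_powR_subr a c x : c < x ->
  is_derive x 1 (fun y => (y - c) `^ a) (a * (x - c) `^ (a - 1)).
Proof.
rewrite -subr_gt0 => cx; rewrite -[X in is_derive _ _ _ X]mulr1.
exact: (is_derive1_comp (g := fun y => y - c)
          (is_derive1_powR a cx) (is_derive1_subr c x)).
Qed.

Lemma is_derive1_expRN x : is_derive x 1 (fun y => expR (- y)) (- expR (- x)).
Proof.
rewrite -mulrN1.
exact: (is_derive1_comp (g := fun y => - y) (is_derive_expR (- x))
                        (is_deriveN (is_derive_id x 1))).
Qed.

End Derivatives.

(** * The Gamma integral *)

Section GammaFunction.
Variable R : realType.
Local Notation mu := (@lebesgue_measure R).
Implicit Types (f F : R -> R) (a b x t : R).

Definition Gamma_integrand x t : R := t `^ (x - 1) * expR (- t).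

Lemma is_derive_within_continuous f F a b : 0 < a ->
  (forall t, 0 < t -> is_derive t 1 F (f t)) ->
  {within `[a, b]%classic, continuous F}%classic.
Proof.
move=> a0 dF; apply: derivable_within_continuous => t.
rewrite in_itv/= => /andP[+ _] => /(lt_le_trans a0)/dF dFt.
exact: ex_derive.
Qed.

(** The fundamental theorem of calculus on a segment of the open half-line; the derivative [df] of
    the integrand supplies the continuity it asks for. *)
Lemma integral_is_derive f F df a b : 0 < a -> a < b ->
  (forall t, 0 < t -> is_derive t 1 f (df t)) ->
  (forall t, 0 < t -> is_derive t 1 F (f t)) ->
  (\int[mu]_(t in `[a, b]) (f t)%:E = (F b - F a)%:E)%E.
Proof.
move=> a0 ab df_ dF; rewrite EFinB; apply: continuous_FTC2 => //.
- exact: is_derive_within_continuous df_.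
- have /(continuous_within_itvP _ ab)[_ ? ?] :=
    is_derive_within_continuous (b := b) a0 dF.
  split => // t; rewrite in_itv/= => /andP[+ _] => /(lt_trans a0)/dF dFt.
  exact: ex_derive.
- move=> t; rewrite in_itv/= => /andP[+ _] => /(lt_trans a0)/dF dFt.
  by rewrite derive1E; exact: derive_val.
Qed.

Lemma integrable_is_derive f df a b : 0 < a ->
  (forall t, 0 < t -> is_derive t 1 f (df t)) ->
  mu.-integrable `[a, b] (EFin \o f).
Proof.
move=> a0 df_; apply: continuous_compact_integrable.
  exact: segment_compact.
exact: is_derive_within_continuous df_.
Qed.

(** The segments [[1/(n+1), n+2]] exhaust the half-line; the offset in [hi] makes them nondegenerate
    from [n = 0] on. *)
Let lo n : R := n.+1%:R^-1.
Let hi n : R := n.+2%:R.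

Let lo_gt0 n : 0 < lo n. Proof. by rewrite invr_gt0. Qed.

Let lo_lt_hi n : lo n < hi n.
Proof.
apply: (@le_lt_trans _ _ 1); last by rewrite ltr1n.
by rewrite invf_le1// ler1n.
Qed.

Lemma segment_sub_itv0y n : (`[lo n, hi n] `<=` `]0%R, +oo[)%classic.
Proof.
move=> t /=; rewrite !in_itv/= => /andP[+ _].
by rewrite andbT; exact: lt_le_trans.
Qed.

Lemma measurable_is_derive f df :
  (forall t, 0 < t -> is_derive t 1 f (df t)) ->
  measurable_fun (`]0%R, +oo[%classic : set R) f.
Proof.
move=> df_; apply: open_continuous_measurable_fun; first exact: interval_open.
move=> t; rewrite inE/= in_itv/= andbT => t0.
apply: differentiable_continuous; apply/derivable1_diffP.
have dft := df_ t t0; exact: ex_derive.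
Qed.

Lemma cvg_integral_exhaustion f df : (forall t, 0 < t -> 0 <= f t) ->
  (forall t, 0 < t -> is_derive t 1 f (df t)) ->
  (\int[mu]_(t in `[lo n, hi n]) (f t)%:E @[n --> \oo] -->
   \int[mu]_(t in `]0%R, +oo[) (f t)%:E)%E%classic.
Proof.
move=> f0 df_.
pose g n := ((EFin \o f) \_ `[lo n, hi n]).
have sub := segment_sub_itv0y.
have mf := measurable_is_derive df_.
have -> : (fun n => \int[mu]_(t in `[lo n, hi n]) (f t)%:E)%E =
          (fun n => \int[mu]_(t in `]0%R, +oo[) g n t)%E.
  apply/funext => n; rewrite integral_mkcond [RHS]integral_mkcond.
  by rewrite -patch_setI setIidr.
have -> : (\int[mu]_(t in `]0%R, +oo[) (f t)%:E =
           \int[mu]_(t in `]0%R, +oo[) (limn (g^~ t)))%E.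
  (* At a fixed [t] the restrictions are constant once [n] exceeds both [t] and [1 / t]. *)
  apply: eq_integral => t; rewrite inE/= in_itv/= andbT => t0.
  apply/esym/cvg_lim => //; apply: cvg_near_cst.
  near=> n; rewrite /g patchE mem_set//= in_itv/=; apply/andP; split.
    rewrite /lo invf_ple ?posrE//.
    by near: n; apply: filterS (nbhs_infty_ger (t^-1)) => n /le_trans; apply;
      rewrite ler_nat.
  by near: n; apply: filterS (nbhs_infty_ger t) => n /le_trans; apply;
    rewrite ler_nat -addn2 leq_addr.
apply: cvg_monotone_convergence => //.
- move=> n; apply/measurable_restrict => //; rewrite setIidr//.
  apply: measurable_funS (sub n) _ => //; exact/measurable_EFinP.
- move=> n t; rewrite /= in_itv/= andbT => t0.
  by rewrite /g patchE; case: ifP => // _; rewrite lee_fin f0.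
- move=> t; rewrite /= in_itv/= andbT => t0 n m nm.
  rewrite /g !patchE; case: ifP => [|_]; last first.
    by case: ifP => // _; rewrite lee_fin f0.
  rewrite inE/= in_itv/= => /andP[t1 t2]; rewrite mem_set//= in_itv/=.
  rewrite (le_trans _ t1) ?(le_trans t2)//.
    by rewrite ler_nat !ltnS.
  by rewrite lef_pV2 ?posrE// ler_nat ltnS.
Unshelve. all: by end_near. Qed.

Lemma is_derive_Gamma_integrand x t : 0 < t ->
  is_derive t 1 (Gamma_integrand x)
    ((x - 1) * t `^ (x - 1 - 1) * expR (- t) + t `^ (x - 1) * - expR (- t)).
Proof.
by move=> t0; apply: is_derive1M (is_derive1_expRN _); exact: is_derive1_powR.
Qed.

Lemma Gamma_integrand_ge0 x t : 0 <= Gamma_integrand x t.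
Proof. by rewrite mulr_ge0// ?powR_ge0// expR_ge0. Qed.

(** The inequality [1 + y <= exp y] at [y = ln ((t + 1) / (x + 1))] bounds [(x + 1) ln (t + 1)]
    linearly in [t]. Writing [t - (-1)] matches the shape of [is_derive1_powR_subr]. *)
Lemma expRN_le_powR x : 0 < x ->
  exists2 C : R, 0 < C &
    forall t, 0 < t -> expR (- t) <= C * (t - (-1)) `^ (- (x + 1)).
Proof.
move=> x0; have x10 : 0 < x + 1 by rewrite addr_gt0.
exists (expR (1 + (x + 1) * ln (x + 1))); first exact: expR_gt0.
move=> t t0; have t10 : 0 < t - (-1) by rewrite opprK addr_gt0.
rewrite /powR gt_eqF// -expRD ler_expR.
have xt0 : 0 < (t - (-1)) / (x + 1) by rewrite divr_gt0.
have := expR_ge1Dx (ln ((t - (-1)) / (x + 1))).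
rewrite lnK ?posrE// ln_div ?posrE// => h.
have : (x + 1) * (1 + (ln (t - (-1)) - ln (x + 1))) <= t - (-1).
  by rewrite mulrC -ler_pdivlMr.
by lra.
Qed.

(* Dominating exp (- t) by C (1 + t) ^ (- x - 1) turns the integrand into the
   exact derivative of (t / (1 + t)) ^ x / x. *)
Lemma is_derive_beta_primitive x t : 0 < x -> 0 < t ->
  is_derive t 1 (fun u => x^-1 * (u `^ x * (u - (-1)) `^ (- x)))
    (t `^ (x - 1) * (t - (-1)) `^ (- (x + 1))).
Proof.
move=> x0 t0; have t10 : 0 < t - (-1) by rewrite opprK addr_gt0.
apply: is_derive_eq.
  apply: is_derive1Zl; apply: is_derive1M.
    exact: is_derive1_powR.
  by apply: is_derive1_powR_subr; rewrite -subr_gt0.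
have -> : - x - 1 = - (x + 1) by ring.
have -> : t `^ x = t `^ (x - 1) * t.
  rewrite -[X in _ * X]powRr1 ?ltW// -powRD ?(gt_eqF t0) ?implybT//.
  by congr (_ `^ _); ring.
have -> : (t - (-1)) `^ (- x) = (t - (-1)) `^ (- (x + 1)) * (t - (-1)).
  rewrite -[X in _ * X]powRr1 ?ltW// -powRD ?(gt_eqF t10) ?implybT//.
  by congr (_ `^ _); ring.
by field; rewrite gt_eqF.
Qed.

Lemma integral_Gamma_integrand_lt_pinfty x : 0 < x ->
  (\int[mu]_(t in `]0%R, +oo[) (Gamma_integrand x t)%:E < +oo)%E.
Proof.
move=> x0; have [C C0 CP] := expRN_le_powR x0.
pose B t := C * (t `^ (x - 1) * (t - (-1)) `^ (- (x + 1))).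
pose F t := C * (x^-1 * (t `^ x * (t - (-1)) `^ (- x))).
have dF t : 0 < t -> is_derive t 1 F (B t).
  by move=> t0; apply: is_derive1Zl; exact: is_derive_beta_primitive.
have dB t : 0 < t -> is_derive t 1 B (C *
    (((x - 1) * t `^ (x - 1 - 1)) * (t - (-1)) `^ (- (x + 1)) +
     t `^ (x - 1) * (- (x + 1) * (t - (-1)) `^ (- (x + 1) - 1)))).
  move=> t0; apply: is_derive1Zl; apply: is_derive1M.
    exact: is_derive1_powR.
  by apply: is_derive1_powR_subr; rewrite -subr_gt0 opprK addr_gt0.
apply: (@le_lt_trans _ _ (C * x^-1)%:E); last exact: ltry.
have cv := cvg_integral_exhaustion (fun t _ => Gamma_integrand_ge0 x t)
  (@is_derive_Gamma_integrand x).
rewrite -(cvg_lim _ cv)//; apply: lime_le.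
  by apply/cvg_ex; eexists; exact: cv.
apply: nearW => n.
apply: (@le_trans _ _ (\int[mu]_(t in `[lo n, hi n]) (B t)%:E)%E).
  apply: ge0_le_integral => //.
  - by move=> t _; rewrite lee_fin Gamma_integrand_ge0.
  - apply/measurable_EFinP.
    have mG := measurable_is_derive (@is_derive_Gamma_integrand x).
    apply: measurable_funS mG => //.
    exact: segment_sub_itv0y.
  - apply/measurable_EFinP.
    apply: measurable_funS (measurable_is_derive dB) => //.
    exact: segment_sub_itv0y.
  - move=> t /segment_sub_itv0y /=; rewrite in_itv/= andbT => t0.
    rewrite lee_fin /Gamma_integrand /B mulrCA.
    by apply: ler_wpM2l; [exact: powR_ge0|exact: CP].
rewrite (integral_is_derive (lo_gt0 n) (lo_lt_hi n) dB dF) lee_fin.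
(* The primitive is nonnegative at the lower end and at most [C / x] at the upper end, because
   [t / (1 + t) < 1]. *)
rewrite (@le_trans _ _ (F (hi n)))//.
  rewrite lerBlDr lerDl /F !mulr_ge0 ?powR_ge0//; last by rewrite invr_ge0 ltW.
  exact: ltW.
rewrite ler_pM2l// ger_pMr ?invr_gt0// powRN.
have h0 : 0 < hi n by rewrite /hi ltr0n.
rewrite ler_pdivrMr ?powR_gt0// ?opprK ?addr_gt0// mul1r.
by apply: ge0_ler_powR; rewrite ?nnegrE ?ltW// ?addr_gt0// ltrDl.
Qed.

Lemma fin_num_integral_Gamma_integrand x : 0 < x ->
  (\int[mu]_(t in `]0%R, +oo[) (Gamma_integrand x t)%:E)%E \is a fin_num.
Proof.
move=> x0; rewrite ge0_fin_numE ?integral_Gamma_integrand_lt_pinfty//.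
by apply: integral_ge0 => t _; rewrite lee_fin Gamma_integrand_ge0.
Qed.

Lemma EFin_Gamma_integral x : 0 < x -> (Gamma_integral x)%:E =
  (\int[mu]_(t in `]0%R, +oo[) (Gamma_integrand x t)%:E)%E.
Proof. by move=> x0; rewrite fineK// fin_num_integral_Gamma_integrand. Qed.

(** On [[1, 2]] the integrand is at least [exp (- 2) / 2], since [t ^ (x - 1) >= t ^ (- 1)]
    there. *)
Lemma Gamma_integral_gt0 x : 0 < x -> 0 < Gamma_integral x.
Proof.
move=> x0; rewrite -lte_fin EFin_Gamma_integral//.
pose one : R := 1; pose two : R := 2.
pose c := expR (- 2%:R) / 2 : R.
have c0 : 0 < c by rewrite divr_gt0// expR_gt0.
have sub12 : ((`[one, two] : set R) `<=` `]0%R, +oo[)%classic.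
  move=> t /=; rewrite !in_itv/= => /andP[+ _].
  by rewrite andbT; exact: lt_le_trans.
apply: (@lt_le_trans _ _ (\int[mu]_(t in `[one, two]) (cst c%:E t))%E).
  rewrite integral_cst//= lebesgue_measure_itv/= lte_fin ltr1n.
  by rewrite -EFinB -EFinM lte_fin mulr_gt0// subr_gt0 ltr1n.
have mG := measurable_is_derive (@is_derive_Gamma_integrand x).
apply: (@le_trans _ _ (\int[mu]_(t in `[one, two]) (Gamma_integrand x t)%:E)%E).
  apply: ge0_le_integral => //.
  - by move=> t _; rewrite lee_fin ltW.
  - apply/measurable_EFinP; exact: measurable_funS sub12 mG.
  - move=> t /=; rewrite in_itv/= => /andP[t1 t2].
    have t0 : 0 < t by exact: lt_le_trans t1.
    rewrite lee_fin /c mulrC; apply: ler_pM => //.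
    + apply: (@le_trans _ _ (t `^ (-1))).
        by rewrite (powR_inv1 (ltW t0)) lef_pV2 ?posrE.
      by rewrite ler_powR// lerBrDl subrr ltW.
    + by rewrite ler_expR lerN2.
apply: ge0_subset_integral => //; first exact/measurable_EFinP.
by move=> t _; rewrite lee_fin Gamma_integrand_ge0.
Qed.

Lemma is_derive_powR_expRN x t : 0 < t ->
  is_derive t 1 (fun u => u `^ x * expR (- u))
    (x * Gamma_integrand x t - Gamma_integrand (x + 1) t).
Proof.
move=> t0.
have -> : x * Gamma_integrand x t - Gamma_integrand (x + 1) t =
    (x * t `^ (x - 1)) * expR (- t) + t `^ x * - expR (- t).
  by rewrite /Gamma_integrand addrK; ring.
by apply: is_derive1M (is_derive1_expRN _); exact: is_derive1_powR.
Qed.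

Lemma cvg_powR_expRN_hi x : 0 < x ->
  ((hi n) `^ x * expR (- (hi n)) @[n --> \oo] --> (0 : R))%classic.
Proof.
move=> x0; have [C C0 CP] := expRN_le_powR x0.
apply: (@squeeze_cvgr _ _ _ _ (cst 0) (fun n => C * harmonic n)).
- apply: nearW => n; rewrite mulr_ge0 ?powR_ge0 ?expR_ge0//=.
  have h0 : 0 < hi n by rewrite /hi ltr0n.
  apply: (@le_trans _ _ (hi n `^ x * (C * (hi n) `^ (- (x + 1))))).
    apply: ler_wpM2l; first exact: powR_ge0.
    apply: le_trans (CP _ h0) _; rewrite ler_pM2l//.
    rewrite !powRN lef_pV2 ?posrE ?powR_gt0// ?opprK ?addr_gt0//.
    by apply: ge0_ler_powR; rewrite ?nnegrE ?ltW// ?addr_gt0// ltrDl.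
  rewrite mulrCA ler_pM2l// -powRD ?(gt_eqF h0) ?implybT//.
  have -> : x + - (x + 1) = -1 by ring.
  by rewrite (powR_inv1 (ltW h0)) lef_pV2 ?posrE// ler_nat.
- exact: cvg_cst.
- rewrite -[X in (_ --> X)%classic](mulr0 C).
  by apply: cvgMr; exact: cvg_harmonic.
Qed.

Lemma cvg_powR_expRN_lo x : 0 < x ->
  ((lo n) `^ x * expR (- (lo n)) @[n --> \oo] --> (0 : R))%classic.
Proof.
move=> x0; apply: (@squeeze_cvgr _ _ _ _ (cst 0) (fun n => lo n `^ x)).
- apply: nearW => n; rewrite mulr_ge0 ?powR_ge0 ?expR_ge0//=.
  by rewrite ger_pMr ?powR_gt0// -expR0 ler_expR oppr_le0 ltW.
- exact: cvg_cst.
- have := @powR_cvg0 R x x0; move/cvg_at_rightP; apply; split => //.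
  exact: cvg_harmonic.
Qed.

(** Integration by parts on the exhausting segments, whose boundary terms [B n] tend to 0. *)
Lemma Gamma_integralS x : 0 < x ->
  Gamma_integral (x + 1) = x * Gamma_integral x.
Proof.
move=> x0; have x10 : 0 < x + 1 by rewrite addr_gt0.
apply: EFin_inj; rewrite EFinM !EFin_Gamma_integral//.
pose J y n := (\int[mu]_(t in `[lo n, hi n]) (Gamma_integrand y t)%:E)%E.
have cJ y := cvg_integral_exhaustion (fun t _ => Gamma_integrand_ge0 y t)
  (@is_derive_Gamma_integrand y).
pose B n : R := (hi n) `^ x * expR (- (hi n)) - (lo n) `^ x * expR (- (lo n)).
have JE n : (J (x + 1)%R n + (B n)%:E = x%:E * J x n)%E.
  pose df t := x * Gamma_integrand x t - Gamma_integrand (x + 1) t.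
  have ddf t : 0 < t -> is_derive t 1 df
      (x * ((x - 1) * t `^ (x - 1 - 1) * expR (- t) +
            t `^ (x - 1) * - expR (- t)) -
       ((x + 1 - 1) * t `^ (x + 1 - 1 - 1) * expR (- t) +
        t `^ (x + 1 - 1) * - expR (- t))).
    move=> t0; apply: is_derive1D.
      by apply: is_derive1Zl; exact: is_derive_Gamma_integrand.
    by apply: is_deriveN; exact: is_derive_Gamma_integrand.
  have := integral_is_derive (lo_gt0 n) (lo_lt_hi n) ddf
    (@is_derive_powR_expRN x).
  rewrite -/(B n) => <-.
  have i1 := integrable_is_derive (hi n) (lo_gt0 n)
    (@is_derive_Gamma_integrand (x + 1)).
  have i2 := integrable_is_derive (hi n) (lo_gt0 n) ddf.
  rewrite /J -(integralD_EFin _ i1 i2)//= -ge0_integralZl_EFin ?ltW//;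
    last 2 first.
  - by move=> t _; rewrite lee_fin Gamma_integrand_ge0.
  - apply/measurable_EFinP.
    have mG := measurable_is_derive (@is_derive_Gamma_integrand x).
    apply: measurable_funS mG => //.
    exact: segment_sub_itv0y.
  by apply: eq_integral => t _; rewrite /df -EFinD -EFinM addrC subrK.
have B0 : ((B n)%:E @[n --> \oo] --> (0%R)%:E)%E%classic.
  apply: cvg_EFin; first exact: nearW.
  rewrite -(subr0 (0:R)).
  by apply: cvgB; [exact: cvg_powR_expRN_hi|exact: cvg_powR_expRN_lo].
have : (J (x + 1)%R n + (B n)%:E @[n --> \oo] -->
    \int[mu]_(t in `]0%R, +oo[) (Gamma_integrand (x + 1)%R t)%:E + 0)%E%classic.
  apply: cvgeD; [exact: fin_num_adde_defl|exact: cJ|exact: B0].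
under eq_fun do rewrite JE.
rewrite adde0 => c1.
have c2 : (x%:E * J x n @[n --> \oo] -->
    x%:E * \int[mu]_(t in `]0%R, +oo[) (Gamma_integrand x t)%:E)%E%classic.
  by apply: cvgeZl => //; exact: cJ.
exact: (cvg_unique _ c1 c2).
Qed.

End GammaFunction.

(** * Completely monotone functions and sequences *)

Section CompletelyMonotone.
Variable R : realType.
Implicit Types (a b c x y s t : R) (f g : R -> R) (A B : nat -> R).
Implicit Types (j k m n : nat).

(* Complete monotonicity up to order k only, so that products and successive
   derivatives are handled by induction on k. *)
Fixpoint cm_fun c k f : Prop :=
  (forall x, c < x -> 0 <= f x) /\
  if k is k'.+1 then
    exists2 g, (forall x, c < x -> is_derive x 1 f (- g x)) & cm_fun c k' g
  else True.

Definition dif A : nat -> R := fun m => A m - A m.+1.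

Fixpoint cm_seq k A : Prop :=
  (forall m, 0 <= A m) /\ if k is k'.+1 then cm_seq k' (dif A) else True.

Lemma cm_fun_ge0 c k f : cm_fun c k f -> forall x, c < x -> 0 <= f x.
Proof. by case: k => [|k] []. Qed.

Lemma cm_funW c k f : cm_fun c k.+1 f -> cm_fun c k f.
Proof.
elim: k f => [|k IHk] f /= [f0 [g dfg cg]]; first by split.
by split => //; exists g => //; exact: IHk.
Qed.

Lemma cm_funD c k f g : cm_fun c k f -> cm_fun c k g ->
  cm_fun c k (fun x => f x + g x).
Proof.
elim: k f g => [|k IHk] f g [f0 cf] [g0 cg]; split => //=.
- by move=> x cx; rewrite addr_ge0 ?f0 ?g0.
- by move=> x cx; rewrite addr_ge0 ?f0 ?g0.
case: cf => f' df cf'; case: cg => g' dg cg'.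
exists (fun x => f' x + g' x); last exact: IHk.
by move=> x cx; rewrite opprD; apply: is_derive1D; [exact: df|exact: dg].
Qed.

Lemma cm_funZ c k a f : 0 <= a -> cm_fun c k f -> cm_fun c k (fun x => a * f x).
Proof.
move=> a0; elim: k f => [|k IHk] f [f0 cf]; split => //=.
- by move=> x cx; rewrite mulr_ge0 ?f0.
- by move=> x cx; rewrite mulr_ge0 ?f0.
case: cf => f' df cf'; exists (fun x => a * f' x); last exact: IHk.
by move=> x cx; rewrite -mulrN; apply: is_derive1Zl; exact: df.
Qed.

Lemma cm_funM c k f g : cm_fun c k f -> cm_fun c k g ->
  cm_fun c k (fun x => f x * g x).
Proof.
elim: k f g => [|k IHk] f g cf cg.
  by split => // x cx; rewrite mulr_ge0 ?(cm_fun_ge0 cf) ?(cm_fun_ge0 cg).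
split; first by move=> x cx; rewrite mulr_ge0 ?(cm_fun_ge0 cf) ?(cm_fun_ge0 cg).
have [_ [f' df cf']] := cf; have [_ [g' dg cg']] := cg.
exists (fun x => f' x * g x + f x * g' x); last first.
  by apply: cm_funD; apply: IHk => //; exact: cm_funW.
move=> x cx; rewrite opprD -mulNr -mulrN.
by apply: is_derive1M; [exact: df|exact: dg].
Qed.

Lemma cm_fun_powRN c k b a : b <= c -> 0 <= a ->
  cm_fun c k (fun x => (x - b) `^ (- a)).
Proof.
move=> bc; elim: k a => [|k IHk] a a0; first by split=> // x _; exact: powR_ge0.
split=> [x _|]; first exact: powR_ge0.
exists (fun x => a * (x - b) `^ (- (a + 1))).
  move=> x cx; rewrite -mulNr opprD; apply: is_derive1_powR_subr.
  exact: le_lt_trans cx.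
by apply: cm_funZ => //; apply: IHk; rewrite addr_ge0.
Qed.

Lemma cm_fun_nonincreasing c k f x y : cm_fun c k.+1 f -> c < x -> x <= y ->
  f y <= f x.
Proof.
move=> [_ [g df cg]] cx xy.
have cz z : z \in `[x, y] -> c < z.
  by rewrite in_itv/= => /andP[xz _]; exact: lt_le_trans xz.
have cz' z : z \in `]x, y[ -> c < z.
  by rewrite in_itv/= => /andP[xz _]; exact: lt_trans xz.
apply: (@ler0_derive1_nincr R f x y) => //.
- by move=> z /cz'/df dfz; exact: ex_derive.
- move=> z /cz' cz0; rewrite derive1E; have dfz := df z cz0.
  by rewrite derive_val oppr_le0 (cm_fun_ge0 cg).
- apply: derivable_within_continuous => z /cz cz0; have dfz := df z cz0.
  exact: ex_derive.
Qed.

(** The order drops by one because the sign of a difference is read off the sign of one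
    derivative. *)
Lemma cm_fun_dif c k f : cm_fun c k.+1 f ->
  cm_fun c k (fun x => f x - f (x + 1)).
Proof.
have c1 x : c < x -> c < x + 1 by move=> cx; rewrite (lt_trans cx)// ltrDl.
elim: k f => [|k IHk] f cf.
  split => // x cx; rewrite subr_ge0.
  by apply: (cm_fun_nonincreasing cf) => //; rewrite lerDl.
split.
  move=> x cx; rewrite subr_ge0.
  by apply: (cm_fun_nonincreasing cf) => //; rewrite lerDl.
have [_ [g df cg]] := cf; exists (fun x => g x - g (x + 1)); last exact: IHk.
move=> x cx; rewrite opprD opprK; apply: is_derive1D; first exact: df.
rewrite -[g (x + 1)]opprK; apply: is_deriveN.
rewrite -[X in is_derive _ _ _ X]mulr1.
exact: (is_derive1_comp (g := fun y => y + 1) (df _ (c1 _ cx))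
          (is_derive1_addr 1 x)).
Qed.

Lemma cm_seq_cm_fun c k f x : c < x -> cm_fun c k f ->
  cm_seq k (fun m => f (x + m%:R)).
Proof.
move=> cx; have cxm m : c < x + m%:R by rewrite (lt_le_trans cx)// lerDl.
elim: k f => [|k IHk] f cf.
  by split => // m; exact: (cm_fun_ge0 cf).
split; first by move=> m; exact: (cm_fun_ge0 cf).
have -> : dif (fun m => f (x + m%:R)) =
    (fun m => (fun y => f y - f (y + 1)) (x + m%:R)).
  by apply/funext => m; rewrite /dif -natr1 addrA.
exact: (IHk (fun y => f y - f (y + 1)) (cm_fun_dif cf)).
Qed.

Lemma cm_seq_ge0 k A m : cm_seq k A -> 0 <= A m.
Proof. by case: k => [|k] [H _]; exact: H. Qed.

Lemma cm_seqW k A : cm_seq k.+1 A -> cm_seq k A.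
Proof.
elim: k A => [|k IHk] A [A0 cA]; first by split.
by split => //; exact: IHk.
Qed.

Lemma cm_seq_shift k A : cm_seq k A -> cm_seq k (fun m => A m.+1).
Proof.
elim: k A => [|k IHk] A [A0 cA]; first by split.
by split => //; exact: IHk cA.
Qed.

Lemma difM A B : dif (fun m => A m * B m) =
  (fun m => A m.+1 * dif B m + dif A m * B m).
Proof. by apply/funext => m; rewrite /dif; ring. Qed.

Lemma difD A B : dif (fun m => A m + B m) = (fun m => dif A m + dif B m).
Proof. by apply/funext => m; rewrite /dif; ring. Qed.

Lemma cm_seqD k A B : cm_seq k A -> cm_seq k B -> cm_seq k (fun m => A m + B m).
Proof.
elim: k A B => [|k IHk] A B cA cB.
  by split => // m; rewrite addr_ge0 ?(cm_seq_ge0 _ cA) ?(cm_seq_ge0 _ cB).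
split=> [m|]; first by rewrite addr_ge0 ?(cm_seq_ge0 _ cA) ?(cm_seq_ge0 _ cB).
by rewrite difD; apply: IHk; [case: cA|case: cB].
Qed.

Lemma cm_seqM k A B : cm_seq k A -> cm_seq k B -> cm_seq k (fun m => A m * B m).
Proof.
elim: k A B => [|k IHk] A B cA cB.
  by split => // m; rewrite mulr_ge0 ?(cm_seq_ge0 _ cA) ?(cm_seq_ge0 _ cB).
split=> [m|]; first by rewrite mulr_ge0 ?(cm_seq_ge0 _ cA) ?(cm_seq_ge0 _ cB).
rewrite difM; apply: cm_seqD; apply: IHk.
- exact/cm_seqW/cm_seq_shift.
- by case: cB.
- by case: cA.
- exact: cm_seqW.
Qed.

Lemma iter_difD k A B m :
  iter k dif (fun m => A m + B m) m = iter k dif A m + iter k dif B m.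
Proof. by elim: k A B => [|k IHk] A B//; rewrite !iterSr difD IHk. Qed.

Lemma cm_seq_iter_dif_ge0 k A m : cm_seq k A -> 0 <= iter k dif A m.
Proof.
elim: k A => [|k IHk] A cA; first exact: (cm_seq_ge0 _ cA).
by rewrite iterSr; apply: IHk; case: cA.
Qed.

(** All terms of the Leibniz expansion are nonnegative; the one kept has every difference on [B],
    which shifts [A] by [k]. *)
Lemma le_iter_difM k A B m : cm_seq k A -> cm_seq k B ->
  A (m + k)%N * iter k dif B m <= iter k dif (fun m => A m * B m) m.
Proof.
elim: k A B m => [|k IHk] A B m cA cB; first by rewrite addn0.
rewrite !iterSr difM (iter_difD k (fun m => A m.+1 * dif B m)) -[leLHS]addr0.
apply: lerD.
  rewrite addnS; apply: (IHk (fun m => A m.+1)); last by case: cB.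
  exact/cm_seqW/cm_seq_shift.
apply/cm_seq_iter_dif_ge0/cm_seqM; first by case: cA.
exact: cm_seqW.
Qed.

(** Strictness comes from one more Leibniz term, with a single difference on [A] and the other [k]
    on [B]. *)
Lemma lt_iter_difM k A B m : cm_seq k.+1 A -> cm_seq k.+1 B ->
  0 < dif A (m + k)%N -> 0 < iter k dif B m ->
  A (m + k.+1)%N * iter k.+1 dif B m < iter k.+1 dif (fun m => A m * B m) m.
Proof.
move=> cA cB dA0 dB0.
rewrite !iterSr difM (iter_difD k (fun m => A m.+1 * dif B m)) -[ltLHS]addr0.
apply: ler_ltD.
  rewrite addnS; apply: (@le_iter_difM k (fun m => A m.+1)); last by case: cB.
  exact/cm_seqW/cm_seq_shift.
apply: (@lt_le_trans _ _ (dif A (m + k)%N * iter k dif B m)).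
  exact: mulr_gt0.
by apply: le_iter_difM; [case: cA|exact: cm_seqW].
Qed.

End CompletelyMonotone.

Arguments dif {R} A m.

(** * Rising binomial coefficients *)

Section RisingBinomial.
Variable R : realType.
Implicit Types (x y a : R) (m n : nat).

(* (x)_m / m!: up to a constant factor, the sequence of the theorem is
   rbin (1/q + l) (n - l), and a backward difference lowers x by 1. *)
Definition rbin x m : R := pochhammer x m / m`!%:R.

Lemma pochhammerS x m : pochhammer x m.+1 = pochhammer x m * (x + m%:R).
Proof. by rewrite /pochhammer big_ord_recr. Qed.

Lemma pochhammer_gt0 x m : 0 < x -> 0 < pochhammer x m.
Proof. by move=> x0; apply: prodr_gt0 => i _; rewrite ltr_wpDr. Qed.

Lemma pochhammerD x m n : pochhammer x (m + n) =
  pochhammer x m * pochhammer (x + m%:R) n.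
Proof.
elim: n => [|n IHn]; first by rewrite addn0 /pochhammer big_ord0 mulr1.
by rewrite addnS !pochhammerS IHn natrD addrA mulrA.
Qed.

Lemma pochhammer1 x : pochhammer x 1 = x.
Proof. by rewrite pochhammerS /pochhammer big_ord0 mul1r addr0. Qed.

Lemma rbin0 x : rbin x 0 = 1.
Proof. by rewrite /rbin /pochhammer big_ord0 fact0 divr1. Qed.

Lemma rbin_gt0 x m : 0 < x -> 0 < rbin x m.
Proof. by move=> x0; rewrite divr_gt0 ?pochhammer_gt0// ltr0n fact_gt0. Qed.

Lemma rbin_ge0 x m : 0 < x -> 0 <= rbin x m.
Proof. by move=> x0; rewrite ltW ?rbin_gt0. Qed.

Lemma rbinS x m : rbin x m.+1 = rbin x m * ((x + m%:R) / m.+1%:R).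
Proof. by rewrite /rbin pochhammerS factS natrM invfM; ring. Qed.

Lemma rbinD1 x m : x * rbin (x + 1) m = (x + m%:R) * rbin x m.
Proof.
have h : x * pochhammer (x + 1) m = pochhammer x m * (x + m%:R).
  by rewrite -pochhammerS -add1n pochhammerD pochhammer1.
by rewrite /rbin mulrA h; ring.
Qed.

(** Pascal's rule, with a real upper parameter. *)
Lemma rbin_diff x m : rbin (x + 1) m.+1 - rbin (x + 1) m = rbin x m.+1.
Proof.
have m0 : (m.+1%:R : R) != 0 by rewrite pnatr_eq0.
rewrite [in LHS]rbinS [in RHS]rbinS.
have -> : rbin x m * ((x + m%:R) / m.+1%:R) = x * rbin (x + 1) m / m.+1%:R.
  by rewrite rbinD1; ring.
by rewrite -natr1; field; rewrite natr1.
Qed.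

Lemma ler_rbin x y m : 0 < x -> x <= y -> rbin x m <= rbin y m.
Proof.
move=> x0 xy; rewrite ler_pM2r ?invr_gt0 ?ltr0n ?fact_gt0//.
apply: ler_prod => i _; rewrite addr_ge0 ?(ltW x0)//=.
by rewrite lerD2r.
Qed.

Lemma rbin1 m : rbin 1 m = 1.
Proof.
elim: m => [|m IHm]; first by rewrite rbin0.
by rewrite rbinS IHm mul1r nat1r divff// pnatr_eq0.
Qed.

End RisingBinomial.

(** * Bernoulli inequalities for real exponents *)

Section PowerInequalities.
Variable R : realType.
Implicit Types (t b p y : R).

Lemma powR_subr1 y b : 0 < y -> y `^ (b - 1) = y `^ b / y.
Proof.
by move=> y0; rewrite powRB ?(gt_eqF y0) ?implybT// (powRr1 (ltW y0)).
Qed.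

Lemma powR_neq0 y b : 0 < y -> y `^ b != 0.
Proof. by move=> y0; rewrite gt_eqF ?powR_gt0. Qed.

Lemma powR_div y t b : 0 < y -> 0 < t -> (y / t) `^ b = y `^ b / t `^ b.
Proof.
move=> y0 t0; rewrite powRM ?invr_ge0 ?(ltW y0) ?(ltW t0)//.
by rewrite -[t^-1](powR_inv1 (ltW t0)) powRAC powR_inv1 ?powR_ge0.
Qed.

(** The bound [1 + y <= exp y] is used twice: strictly at [y = ln (1 - t)], giving
    [ln (1 - t) < - t], and then at [y = - b ln (1 - t)]. *)
Lemma ltr_1DM_powRN t b : t < 1 -> t != 0 -> 0 < b ->
  1 + b * t < (1 - t) `^ (- b).
Proof.
move=> t1 tN0 b0; have t1' : 0 < 1 - t by rewrite subr_gt0.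
have lnN0 : ln (1 - t) != 0.
  by rewrite ln_eq0// -subr_eq0 addrAC subrr add0r oppr_eq0.
rewrite /powR gt_eqF//.
have h1 : ln (1 - t) < - t.
  by have := expR_gt1Dx lnN0; rewrite lnK ?posrE// ltrD2l.
apply: (@lt_le_trans _ _ (1 + - b * ln (1 - t))); last exact: expR_ge1Dx.
by rewrite ltrD2l mulNr -mulrN ltr_pM2l// ltrNr.
Qed.

Lemma ler_1DM_powRN t b : t < 1 -> 0 < b -> 1 + b * t <= (1 - t) `^ (- b).
Proof.
have [->|tN0] := eqVneq t 0; first by rewrite mulr0 subr0 powR1 addr0.
by move=> t1 b0; rewrite ltW// ltr_1DM_powRN.
Qed.

(* Weighting exp x > 1 + x at (p - 1) ln y and at - ln y by 1/p and 1/q makes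
   the logarithms cancel. *)
Lemma ltr_bernoulli_powR y p : 0 <= y -> y != 1 -> 1 < p ->
  1 + p * (y - 1) < y `^ p.
Proof.
move=> y0 yN1 p1; have p0 : 0 < p by exact: lt_trans p1.
move: y0; rewrite le_eqVlt => /predU1P[<-|y0].
  by rewrite powR0 ?gt_eqF// sub0r mulrN1 subr_lt0.
have lnN0 : ln y != 0 by rewrite ln_eq0.
have h1 := expR_gt1Dx lnN0.
have h2 : 1 + (p - 1) * ln y <= expR ((p - 1) * ln y) by exact: expR_ge1Dx.
have h3 : 1 - ln y < y^-1.
  have : - ln y != 0 by rewrite oppr_eq0.
  by move/expR_gt1Dx; rewrite expRN lnK ?posrE.
have yp : y `^ p = y * expR ((p - 1) * ln y).
  rewrite /powR gt_eqF// -[X in _ = X * _]lnK ?posrE// -expRD.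
  by congr expR; ring.
rewrite yp.
have h4 : y * (1 + (p - 1) * ln y) <= y * expR ((p - 1) * ln y).
  by rewrite ler_pM2l.
have h5 : (p - 1) * (y * (1 - ln y)) < p - 1.
  rewrite gtr_pMr ?subr_gt0// mulrC -ltr_pdivlMr// div1r.
  exact: h3.
by lra.
Qed.

Lemma ler_bernoulli_powR y p : 0 <= y -> 1 < p -> 1 + p * (y - 1) <= y `^ p.
Proof.
move=> y0 p1; have [->|yN1] := eqVneq y 1.
  by rewrite subrr mulr0 addr0 powR1.
by rewrite ltW// ltr_bernoulli_powR.
Qed.

End PowerInequalities.

(** * Complete monotonicity of the power ratio and of its excess *)

Section PowerRatio.
Variables (R : realType) (p : R).
Hypothesis p1 : 1 < p.
Implicit Types (x : R) (j k m : nat).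

Let c := p^-1.
Let s := 1 - p^-1.

Let p0 : 0 < p. Proof. exact: lt_trans p1. Qed.
Let c0 : 0 < c. Proof. by rewrite invr_gt0. Qed.
Let c1 : c < 1. Proof. by rewrite invf_lt1. Qed.
Let s0 : 0 < s. Proof. by rewrite subr_gt0. Qed.
Let b0 : 0 < p - 1. Proof. by rewrite subr_gt0. Qed.
Let sE : s = (p - 1) * c.
Proof. by rewrite mulrBl mul1r divff// gt_eqF. Qed.

(** At [x = m + 1] this is the ratio of the terms of rank [m] and [m + 1] of [hardy_base]. The null
    shift [x - 0] lets both factors fall under [is_derive1_powR_subr]. *)
Definition power_ratio x : R := (x - 0) `^ (p - 1) * (x - c) `^ (- (p - 1)).

Let recip x : R := (x - 0) `^ (- 1) * (x - c) `^ (- 1).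

Let recipE x : c < x -> recip x = (x * (x - c))^-1.
Proof.
move=> cx; have x0 : 0 < x by exact: lt_trans cx.
by rewrite /recip subr0 !powR_inv1 ?invfM// ?ltW// subr_gt0.
Qed.

Lemma is_derive_power_ratio x : c < x ->
  is_derive x 1 power_ratio (- (s * (recip x * power_ratio x))).
Proof.
move=> cx; have x0 : 0 < x by exact: lt_trans cx.
have xc0 : 0 < x - c by rewrite subr_gt0.
have -> : - (s * (recip x * power_ratio x)) =
    ((p - 1) * (x - 0) `^ (p - 1 - 1)) * (x - c) `^ (- (p - 1)) +
    (x - 0) `^ (p - 1) * (- (p - 1) * (x - c) `^ (- (p - 1) - 1)).
  rewrite recipE// /power_ratio subr0 !powR_subr1// sE.
  by field; rewrite !gt_eqF.
exact: (is_derive1M (is_derive1_powR_subr _ x0) (is_derive1_powR_subr _ cx)).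
Qed.

Let cm_recip k : cm_fun c k recip.
Proof. by apply: cm_funM; apply: cm_fun_powRN => //; exact: ltW. Qed.

Lemma power_ratio_ge0 x : 0 <= power_ratio x.
Proof. by rewrite mulr_ge0 ?powR_ge0. Qed.

(* The logarithmic derivative of the power ratio is - s / (x (x - c)). *)
Lemma cm_power_ratio k : cm_fun c k power_ratio.
Proof.
elim: k => [|k IHk]; first by split => // x _; exact: power_ratio_ge0.
split; first by move=> x _; exact: power_ratio_ge0.
exists (fun x => s * (recip x * power_ratio x)).
  exact: is_derive_power_ratio.
by apply: cm_funZ; [exact: ltW|exact: cm_funM].
Qed.

(** Minus the derivative of [power_ratio_excess]. *)
Let excess' x : R := 1 - power_ratio x + s * ((x - c) `^ (- 1) * power_ratio x).

(** At infinity [power_ratio x] is [1 + s / x + o(1 / x)]; this is what remains beyond these two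
    terms, multiplied by [x]. *)
Definition power_ratio_excess x : R := x * (power_ratio x - 1) - s.

Lemma power_ratioE x : c < x -> power_ratio x = (1 - c / x) `^ (- (p - 1)).
Proof.
move=> cx; have x0 : 0 < x by exact: lt_trans cx.
have xc0 : 0 < x - c by rewrite subr_gt0.
rewrite /power_ratio subr0.
have -> : 1 - c / x = (x - c) * x^-1 by rewrite mulrBl divff// gt_eqF.
rewrite powRM ?ltW ?invr_gt0// mulrC; congr (_ * _).
by rewrite powRN -[x^-1]powR_inv1 ?ltW// -powRrM -powRN mulN1r opprK.
Qed.

(** Strict Bernoulli at [t = c / x], the linear coefficient being [(p - 1) c = s]. *)
Lemma power_ratio_excess_gt0 x : c < x -> 0 < power_ratio_excess x.
Proof.
move=> cx; have x0 : 0 < x by exact: lt_trans cx.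
have t1 : c / x < 1 by rewrite ltr_pdivrMr// mul1r.
have tN0 : c / x != 0 by rewrite mulf_neq0 ?invr_eq0 ?gt_eqF.
have := ltr_1DM_powRN t1 tN0 b0.
rewrite -power_ratioE// mulrA -sE -ltrBrDl => h.
by rewrite /power_ratio_excess subr_gt0 mulrC -ltr_pdivrMr.
Qed.

(** Bernoulli at [t = - c / (x - c)], for which [1 - t] is the inverse of [1 - c / x]; the result is
    multiplied by the power ratio. *)
Let excess'_ge0 x : c < x -> 0 <= excess' x.
Proof.
move=> cx; have x0 : 0 < x by exact: lt_trans cx.
have xc0 : 0 < x - c by rewrite subr_gt0.
have G0 : 0 < power_ratio x by rewrite mulr_gt0 ?powR_gt0 ?subr0.
have t1 : - (c / (x - c)) < 1 by rewrite (@lt_trans _ _ 0)// oppr_lt0 divr_gt0.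
have := ler_1DM_powRN t1 b0.
have -> : 1 - - (c / (x - c)) = (1 - c / x)^-1 by field; rewrite !gt_eqF.
have t0 : 0 < 1 - c / x by rewrite subr_gt0 ltr_pdivrMr// mul1r.
rewrite -[(1 - c / x)^-1](powR_inv1 (ltW t0)) -powRrM mulN1r opprK.
rewrite mulrN mulrA -sE.
have -> : (1 - c / x) `^ (p - 1) = (power_ratio x)^-1.
  by rewrite power_ratioE// powRN invrK.
rewrite -(ler_pM2r G0) mulVf ?gt_eqF// => h.
rewrite /excess' (powR_inv1 (ltW xc0)).
by move: h; rewrite mulrBl mul1r; lra.
Qed.

(* The second derivative of the excess is s / (x (x - c) ^ 2) times the power
   ratio; its value and first derivative have the right sign by Bernoulli. *)
Lemma cm_power_ratio_excess k : cm_fun c k power_ratio_excess.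
Proof.
(* Raising the order to [k + 2] exposes the first two derivatives for every [k]. *)
apply/cm_funW/cm_funW; split=> [x /power_ratio_excess_gt0/ltW//|].
exists excess' => [x cx|].
  have xc0 : 0 < x - c by rewrite subr_gt0.
  have x0 : 0 < x by exact: lt_trans cx.
  have -> : - excess' x = 1 * (power_ratio x - 1) +
      x * - (s * (recip x * power_ratio x)) - 0.
    rewrite /excess' recipE// powR_inv1 ?ltW//.
    by field; rewrite !gt_eqF.
  apply: is_derive1D; apply: is_derive1M.
  rewrite -[X in is_derive _ _ _ X]addr0.
  by apply: is_derive1D; exact: is_derive_power_ratio.
split; first exact: excess'_ge0.
exists (fun x => s * (recip x * ((x - c) `^ (- 1) * power_ratio x))).
  move=> x cx.
  have xc0 : 0 < x - c by rewrite subr_gt0.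
  have x0 : 0 < x by exact: lt_trans cx.
  have -> : - (s * (recip x * ((x - c) `^ (- 1) * power_ratio x))) =
      0 + - - (s * (recip x * power_ratio x)) +
      s * ((- 1 * (x - c) `^ (- 1 - 1)) * power_ratio x +
           (x - c) `^ (- 1) * - (s * (recip x * power_ratio x))).
    rewrite recipE// powR_subr1// powR_inv1 ?ltW//.
    have -> : s = 1 - c by [].
    by field; rewrite !gt_eqF.
  apply: is_derive1D.
    by apply: is_derive1D; apply: is_deriveN; exact: is_derive_power_ratio.
  apply: is_derive1Zl; apply: is_derive1M; first exact: is_derive1_powR_subr.
  exact: is_derive_power_ratio.
apply: cm_funZ; first exact: ltW.
apply: cm_funM => //; apply: cm_funM; last exact: cm_power_ratio.
by apply: cm_fun_powRN.
Qed.

End PowerRatio.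

(** * Iterated differences of the base sequence *)

Section HardyCoefficients.
Variables (R : realType) (p : R).
Hypothesis p1 : 1 < p.
Implicit Types (j k l m : nat).

Let s := 1 - p^-1.

Let p0 : 0 < p. Proof. exact: lt_trans p1. Qed.
Let c1 : p^-1 < 1. Proof. by rewrite invf_lt1. Qed.
Let s0 : 0 < s. Proof. by rewrite subr_gt0. Qed.
Let s10 : 0 < s + 1. Proof. by rewrite addr_gt0. Qed.

Definition hardy_base m : R := rbin (1 - p^-1) m `^ (p - 1).

(* hardy_base = kappa * h, where h has explicit differences of all orders and
   kappa m = kappa m.+1 * (1 + W m) with W completely monotone. *)
Let h m : R := (rbin (s + 1) m)^-1.
Let kappa m : R := hardy_base m * rbin (s + 1) m.
Let W m : R := power_ratio_excess p (1 + m%:R) * (1 + m%:R - (- s)) `^ (- 1).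

Let cx m : p^-1 < 1 + m%:R.
Proof. by rewrite (lt_le_trans c1)// lerDl. Qed.

Let xs0 m : 0 < 1 + m%:R - (- s).
Proof. by rewrite opprK addr_gt0// ltr_wpDr. Qed.

Let W_gt0 m : 0 < W m.
Proof. by rewrite mulr_gt0 ?powR_gt0// power_ratio_excess_gt0. Qed.

Let cm_W k : cm_seq k W.
Proof.
apply: (@cm_seq_cm_fun _ p^-1 k
  (fun x => power_ratio_excess p x * (x - (- s)) `^ (- 1)) 1) => //.
apply: cm_funM; first exact: cm_power_ratio_excess.
apply: cm_fun_powRN => //.
apply: (@le_trans _ _ 0); last by rewrite invr_ge0 ltW.
by rewrite oppr_le0 ltW.
Qed.

Lemma hardy_base_gt0 m : 0 < hardy_base m.
Proof. by rewrite powR_gt0// rbin_gt0. Qed.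

Let kappa_gt0 m : 0 < kappa m.
Proof. by rewrite mulr_gt0 ?hardy_base_gt0// rbin_gt0. Qed.

(** With [x = m + 1] and [G] the power ratio, [kappa m / kappa m.+1] is [x G x / (x + s)];
    subtracting 1 leaves the excess divided by [x + s], which is [W m]. *)
Let kappaE m : kappa m = kappa m.+1 * (1 + W m).
Proof.
have x0 : 0 < 1 + m%:R :> R by rewrite ltr_wpDr.
have sm0 : 0 < s + m%:R by rewrite ltr_wpDr.
rewrite /kappa /hardy_base !rbinS powRM ?rbin_ge0 ?divr_ge0 ?ltW//.
have -> : ((s + m%:R) / m.+1%:R) `^ (p - 1) = (power_ratio p (1 + m%:R))^-1.
  rewrite /power_ratio invfM powRN invrK subr0 [RHS]mulrC nat1r.
  rewrite powRM ?invr_ge0 ?(ltW sm0)// -[_^-1 in LHS]powR_inv1// -powRrM mulN1r.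
  by rewrite powRN; congr (_ `^ _ * _); rewrite -nat1r /s; ring.
have G0 : power_ratio p (1 + m%:R) != 0.
  by rewrite lt0r_neq0// mulr_gt0// powR_gt0// ?subr0// subr_gt0.
rewrite /W /power_ratio_excess powR_inv1 ?ltW//.
rewrite -nat1r -/s; field; rewrite G0 !gt_eqF//.
Qed.

Let dif_kappa : dif kappa = (fun m => kappa m.+1 * W m).
Proof. by apply/funext => m; rewrite /dif {1}kappaE; ring. Qed.

(** The difference of [kappa] is a shift of [kappa] times [W], so each order follows from the
    previous one. *)
Let cm_kappa k : cm_seq k kappa.
Proof.
elim: k => [|k IHk]; first by split => // m; exact: ltW.
split; first by move=> m; exact: ltW.
rewrite dif_kappa; apply: cm_seqM; last exact: cm_W.
exact: cm_seq_shift.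
Qed.

Let iter_dif_h j m :
  iter j dif h m = pochhammer s j * m`!%:R / pochhammer (s + 1) (m + j).
Proof.
elim: j m => [|j IHj] m.
  by rewrite addn0 /= /h /rbin invf_div /pochhammer big_ord0 mul1r.
rewrite iterS /dif !IHj addSnnS addnS factS !pochhammerS natrM -natr1 natrD.
field; rewrite !gt_eqF ?pochhammer_gt0//.
by rewrite ltr_wpDr// addr_ge0.
Qed.

Let iter_dif_h_gt0 j m : 0 < iter j dif h m.
Proof.
by rewrite iter_dif_h divr_gt0 ?mulr_gt0 ?pochhammer_gt0.
Qed.

Let cm_h k : cm_seq k h.
Proof.
suff : forall j, cm_seq k (iter j dif h) by move=> /(_ 0%N).
elim: k => [|k IHk] j.
  by split => // m; exact/ltW/iter_dif_h_gt0.
split; first by move=> m; exact/ltW/iter_dif_h_gt0.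
by rewrite -iterS; exact: IHk.
Qed.

Let hardy_baseE : hardy_base = (fun m => kappa m * h m).
Proof.
by apply/funext => m; rewrite /kappa /h mulfK// gt_eqF// rbin_gt0.
Qed.

Lemma lt_iter_dif_hardy_base l m : (0 < l)%N ->
  pochhammer s l * (m`!%:R / (m + l)`!%:R) * hardy_base (m + l) <
  iter l dif hardy_base m.
Proof.
case: l => // l _.
(* In the product of [kappa] with the closed form of the differences of [h], the factors
   [(s + 1)_(m + l)] cancel. *)
have -> : pochhammer s l.+1 * (m`!%:R / (m + l.+1)`!%:R) *
    hardy_base (m + l.+1) =
    kappa (m + l.+1) * iter l.+1 dif h m.
  rewrite iter_dif_h /kappa [rbin (s + 1) _]/rbin.
  field; rewrite gt_eqF ?pochhammer_gt0//= pnatr_eq0 -lt0n fact_gt0//.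
rewrite [in ltRHS]hardy_baseE; apply: lt_iter_difM => //.
by rewrite dif_kappa mulr_gt0.
Qed.

Lemma iter_dif_hardy_base_gt0 l m : 0 < iter l dif hardy_base m.
Proof.
case: l => [|l]; first exact: hardy_base_gt0.
apply: le_lt_trans (lt_iter_dif_hardy_base m (ltn0Sn l)).
by rewrite !mulr_ge0 ?invr_ge0// ltW ?pochhammer_gt0 ?hardy_base_gt0.
Qed.

End HardyCoefficients.

(** * Radon's and Picone's inequalities *)

Section ComplexModulus.
Variable R : realType.
Implicit Types x y z : R[i].

Lemma cabsE z : `|z| = (cabs z)%:C.
Proof. by rewrite normc_def; case: z. Qed.

Lemma cabs_ge0 z : 0 <= cabs z.
Proof. by case: z => a b; exact: sqrtr_ge0. Qed.

Lemma cabsM x y : cabs (x * y) = cabs x * cabs y.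
Proof. exact: Normc.normcM. Qed.

Lemma cabs_real (a : R) : cabs a%:C = `|a|.
Proof. by rewrite /cabs /= expr0n addr0 sqrtr_sqr. Qed.

Lemma ler_cabs_sub x y : cabs x <= cabs (x - y) + cabs y.
Proof. by rewrite -[in leLHS](subrK y x); exact: le_normcD. Qed.

(** Equality in the triangle inequality makes [x - y] and [y] nonnegative multiples of one
    direction; the conclusion is stated without division so as to allow zeros. *)
Lemma cabs_sub_eq x y : cabs x = cabs (x - y) + cabs y ->
  (cabs (x - y))%:C * y = (cabs y)%:C * (x - y).
Proof.
move=> h.
have : `|(x - y) + y| = `|x - y| + `|y| by rewrite subrK !cabsE -rmorphD -h.
move=> /normCDeq[t _ []]; rewrite -!cabsE.
set a := `|x - y|; set b := `|y| => h1 h2.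
by rewrite h1 [in LHS]h2; ring.
Qed.

End ComplexModulus.

Section Picone.
Variables (R : realType) (p : R).
Hypothesis p1 : 1 < p.
Implicit Types (a b u v : R).

Let p0 : 0 < p. Proof. exact: lt_trans p1. Qed.

(* The tangent line at t to y ^ p, homogenized: summing it over (u, a) and
   (v, b) with t = (u + v) / (a + b) gives Radon's inequality. *)
Let tangent u a t : 0 <= u -> 0 < a -> 0 < t ->
  a * t `^ p + p * t `^ (p - 1) * (u - a * t) <= u `^ p / a `^ (p - 1)
  ?= iff (u == a * t).
Proof.
move=> u0 a0 t0; have at0 : 0 < a * t by exact: mulr_gt0.
have key : u `^ p / a `^ (p - 1) = a * t `^ p * (u / (a * t)) `^ p.
  rewrite powRM ?invr_ge0 ?(ltW at0)// -[_^-1 in RHS](powR_inv1 (ltW at0)).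
  rewrite -powRrM mulN1r powRN (powRM _ (ltW a0) (ltW t0)) powR_subr1//.
  have ap : a `^ p != 0 by rewrite gt_eqF ?powR_gt0.
  have tp : t `^ p != 0 by rewrite gt_eqF ?powR_gt0.
  by field; rewrite ap tp gt_eqF.
have lin : a * t `^ p + p * t `^ (p - 1) * (u - a * t) =
    a * t `^ p * (1 + p * (u / (a * t) - 1)).
  by rewrite powR_subr1//; field; rewrite !gt_eqF.
have c0 : 0 < a * t `^ p by rewrite mulr_gt0 ?powR_gt0.
have d0 : 0 <= u / (a * t) by rewrite divr_ge0// ltW.
rewrite key lin; split; first by rewrite ler_pM2l// ler_bernoulli_powR.
rewrite (inj_eq (mulfI (lt0r_neq0 c0))).
have -> : (u == a * t) = (u / (a * t) == 1).
  apply/eqP/eqP => [->|h]; first by rewrite divff// gt_eqF.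
  by rewrite -[u](divfK (lt0r_neq0 at0)) h mul1r.
have [->|dN1] := eqVneq (u / (a * t)) 1.
  by rewrite subrr mulr0 addr0 powR1 eqxx.
by apply/negbTE; rewrite lt_eqF// ltr_bernoulli_powR.
Qed.

Lemma radon u v a b : 0 <= u -> 0 <= v -> 0 < a -> 0 < b ->
  (u + v) `^ p / (a + b) `^ (p - 1) <=
  u `^ p / a `^ (p - 1) + v `^ p / b `^ (p - 1) ?= iff (u * b == v * a).
Proof.
move=> u0 v0 a0 b0.
have ab0 : 0 < a + b by exact: addr_gt0.
(* The tangent point [t] must be positive, so [u + v = 0] is treated apart. *)
have := addr_ge0 u0 v0; rewrite le_eqVlt => /predU1P[uv0|uv0].
  have {}v0 : v = 0 by apply/eqP; rewrite eq_le v0 andbT uv0 lerDr.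
  have {}u0 : u = 0 by move: uv0; rewrite v0 addr0 => <-.
  rewrite u0 v0 addr0 (powR0 (lt0r_neq0 p0)) !mul0r addr0 eqxx.
  exact/leif_refl.
pose t := (u + v) / (a + b).
have t0 : 0 < t by rewrite divr_gt0.
have := leifD (tangent u0 a0 t0) (tangent v0 b0 t0).
have -> : (u == a * t) && (v == b * t) = (u * b == v * a).
  apply/andP/eqP => [[/eqP -> /eqP ->]|h]; first by ring.
  have ua : u * (a + b) = a * (u + v) by rewrite mulrDr h; ring.
  have vb : v * (a + b) = b * (u + v) by rewrite mulrDr -h; ring.
  by split; apply/eqP; rewrite /t mulrA -?ua -?vb mulfK// gt_eqF.
have -> // : a * t `^ p + p * t `^ (p - 1) * (u - a * t) +
  (b * t `^ p + p * t `^ (p - 1) * (v - b * t)) =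
  (u + v) `^ p / (a + b) `^ (p - 1).
have ut : u + v = (a + b) * t by rewrite /t mulrC divfK// gt_eqF.
have -> : v = (a + b) * t - u by rewrite -ut; ring.
rewrite [u + (_ - u)]addrC subrK (powRM _ (ltW ab0) (ltW t0)).
rewrite !powR_subr1//; field.
by rewrite (gt_eqF t0) (gt_eqF ab0) gt_eqF ?powR_gt0.
Qed.

(** The triangle inequality [|x| <= |x - y| + |y|], followed by Radon's inequality with denominators
    [a - b] and [b]. *)
Lemma picone (x y : R[i]) a b : 0 < b -> b < a ->
  cabs x `^ p / a `^ (p - 1) - cabs y `^ p / b `^ (p - 1) <=
  cabs (x - y) `^ p / (a - b) `^ (p - 1).
Proof.
move=> b0 ba; have a0 : 0 < a by exact: lt_trans ba.
have ab0 : 0 < a - b by rewrite subr_gt0.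
rewrite lerBlDr.
apply: le_trans (radon (cabs_ge0 (x - y)) (cabs_ge0 y) ab0 b0).
rewrite subrK ler_pM2r ?invr_gt0 ?powR_gt0//.
apply: ge0_ler_powR; rewrite ?nnegrE ?addr_ge0 ?cabs_ge0 ?(ltW p0)//.
exact: ler_cabs_sub.
Qed.

(** Equality must hold in Radon's inequality, which fixes the ratio of the moduli of [x - y] and
    [y], and in the triangle inequality, which aligns their directions. *)
Lemma picone_eq (x y : R[i]) a b : 0 < b -> b < a ->
  cabs x `^ p / a `^ (p - 1) - cabs y `^ p / b `^ (p - 1) =
  cabs (x - y) `^ p / (a - b) `^ (p - 1) -> b%:C * x = a%:C * y.
Proof.
move=> b0 ba h; have a0 : 0 < a by exact: lt_trans ba.
have ab0 : 0 < a - b by rewrite subr_gt0.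
have [le1 eq1] := radon (cabs_ge0 (x - y)) (cabs_ge0 y) ab0 b0.
have le2 : cabs x `^ p / a `^ (p - 1) <=
    (cabs (x - y) + cabs y) `^ p / (a - b + b) `^ (p - 1).
  rewrite subrK ler_pM2r ?invr_gt0 ?powR_gt0//.
  apply: ge0_ler_powR; rewrite ?nnegrE ?addr_ge0 ?cabs_ge0 ?(ltW p0)//.
  exact: ler_cabs_sub.
move/eqP: h; rewrite subr_eq => /eqP h.
have /esym : (cabs (x - y) + cabs y) `^ p / (a - b + b) `^ (p - 1) =
    cabs (x - y) `^ p / (a - b) `^ (p - 1) + cabs y `^ p / b `^ (p - 1).
  by apply/eqP; rewrite eq_le le1 -h le2.
move/eqP; rewrite eq_sym eq1 => /eqP e1.
have e2 : cabs x = cabs (x - y) + cabs y.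
  apply: (powR_injective p0); rewrite ?nnegrE ?addr_ge0 ?cabs_ge0//.
  apply: (mulIf (x := (a `^ (p - 1))^-1)); first by rewrite invr_eq0 powR_neq0.
  move: le1 le2; rewrite subrK => le1 le2.
  by apply/eqP; rewrite eq_le le2 h le1.
have := cabs_sub_eq e2 => e3.
(* For [y = 0] the equality case of Radon gives [x = 0]; otherwise [|y|] can be cancelled. *)
have [cy0|cyN0] := eqVneq (cabs y) 0.
  have y0 := Normc.eq0_normc cy0.
  move: e1; rewrite cy0 mul0r => /eqP.
  rewrite mulf_eq0 (gt_eqF b0) orbF => /eqP.
  by rewrite y0 subr0 => /Normc.eq0_normc ->; rewrite !mulr0.
have cyC : (cabs y)%:C != 0 by apply: contra cyN0 => /eqP[->].
apply: (mulfI cyC).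
have -> : (cabs y)%:C * (b%:C * x) =
    b%:C * ((cabs y)%:C * (x - y)) + b%:C * (cabs y)%:C * y by ring.
rewrite -e3 mulrA -rmorphM mulrC [b * _]mulrC e1.
have -> : a%:C = (a - b)%:C + b%:C :> R[i] by rewrite -rmorphD subrK.
by rewrite rmorphM; ring.
Qed.

End Picone.

(** * The chain of Hardy inequalities *)

Section BackwardDifference.
Variable V : zmodType.
Implicit Types (u v : nat -> V) (k m n : nat).

(** The value at 0 encodes [u (- 1) = 0], as for an element of [Hspace l] shifted by [l]. *)
Definition nab u : nat -> V := fun m => if m is k.+1 then u m - u k else u 0%N.

End BackwardDifference.

Arguments nab {V} u m.

Lemma summation_by_parts (R : comNzRingType) (d X : nat -> R) n :
  \sum_(m < n.+1) d m * nab X m =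
  \sum_(m < n.+1) (d m - d m.+1) * X m + d n.+1 * X n.
Proof.
elim: n => [|n IHn]; first by rewrite !big_ord1 mulrBl subrK.
by rewrite big_ord_recr /= IHn [in RHS]big_ord_recr /=; ring.
Qed.

Section HardyChain.
Variables (R : realType) (p : R).
Hypothesis p1 : 1 < p.
Implicit Types (u : nat -> R[i]) (j k l m n : nat).

Let s := 1 - p^-1.

Let p0 : 0 < p. Proof. exact: lt_trans p1. Qed.
Let s0 : 0 < s. Proof. by rewrite subr_gt0 invf_lt1. Qed.
Let sj0 j : 0 < s + j%:R. Proof. by rewrite ltr_wpDr. Qed.

Let d j := iter j dif (hardy_base p).
Let d_gt0 j m : 0 < d j m. Proof. exact: iter_dif_hardy_base_gt0. Qed.

(** The weight after [j] steps of the chain: constantly 1 for [j = 0], the weight of the theorem for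
    [j = l]. *)
Definition hardy_weight j m : R :=
  iter j dif (hardy_base p) m / rbin (1 - p^-1 + j%:R) m `^ (p - 1).

Lemma hardy_weight_gt0 j m : 0 < hardy_weight j m.
Proof. by rewrite divr_gt0 ?d_gt0// powR_gt0// rbin_gt0. Qed.

Definition hardy_quotient j u m : R :=
  cabs (u m) `^ p / rbin (s + j.+1%:R) m `^ (p - 1).

(** The gap in the Picone inequality for [u] and [rbin (s + j + 1)], whose backward difference is
    [rbin (s + j)]. *)
Definition picone_defect j u m : R :=
  cabs (nab u m) `^ p / rbin (s + j%:R) m `^ (p - 1) -
  nab (hardy_quotient j u) m.

Lemma hardy_quotient_ge0 j u m : 0 <= hardy_quotient j u m.
Proof. by rewrite divr_ge0 ?powR_ge0. Qed.

Let rbin_diffS j m :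
  rbin (s + j.+1%:R) m.+1 - rbin (s + j.+1%:R) m = rbin (s + j%:R) m.+1.
Proof. by rewrite -natr1 addrA rbin_diff. Qed.

Let rbin_incr j m : rbin (s + j.+1%:R) m < rbin (s + j.+1%:R) m.+1.
Proof. by rewrite -subr_gt0 rbin_diffS rbin_gt0. Qed.

Lemma picone_defect_ge0 j u m : 0 <= picone_defect j u m.
Proof.
rewrite subr_ge0; case: m => [|m] /=; first by rewrite /hardy_quotient !rbin0.
have := picone p1 (u m.+1) (u m) (rbin_gt0 m (sj0 j.+1)) (rbin_incr j m).
by rewrite rbin_diffS.
Qed.

Lemma picone_defect_eq0 j u m : picone_defect j u m.+1 = 0 ->
  (rbin (s + j.+1%:R) m)%:C * u m.+1 = (rbin (s + j.+1%:R) m.+1)%:C * u m.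
Proof.
move/eqP; rewrite subr_eq0 eq_sym /= => /eqP h.
apply: (picone_eq p1 (rbin_gt0 m (sj0 j.+1)) (rbin_incr j m)).
by rewrite -/(hardy_quotient j u _) -/(hardy_quotient j u m) h rbin_diffS.
Qed.

(** Summation by parts, kept as an identity: the sign of the last two terms gives the inequality,
    and bounding them from above gives its near-reversal on the test sequences. *)
Lemma hardy_step_eq j u n :
  \sum_(m < n.+1) hardy_weight j m * cabs (nab u m) `^ p =
  \sum_(m < n.+1) hardy_weight j.+1 m * cabs (u m) `^ p +
  d j n.+1 * hardy_quotient j u n + \sum_(m < n.+1) d j m * picone_defect j u m.
Proof.
have -> : \sum_(m < n.+1) hardy_weight j.+1 m * cabs (u m) `^ p =
    \sum_(m < n.+1) (d j m - d j m.+1) * hardy_quotient j u m.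
  apply: eq_bigr => m _.
  by rewrite /hardy_weight /hardy_quotient iterS -/(d j) -/s {1}/dif; ring.
rewrite -summation_by_parts -big_split /=; apply: eq_bigr => m _.
by rewrite -mulrDr /picone_defect addrC subrK /hardy_weight -/(d j) -/s; ring.
Qed.

Lemma hardy_step_ge j u n :
  \sum_(m < n) hardy_weight j.+1 m * cabs (u m) `^ p <=
  \sum_(m < n) hardy_weight j m * cabs (nab u m) `^ p.
Proof.
case: n => [|n]; first by rewrite !big_ord0.
rewrite hardy_step_eq -addrA lerDl.
apply: addr_ge0.
  exact: mulr_ge0 (ltW (d_gt0 _ _)) (hardy_quotient_ge0 _ _ _).
apply: sumr_ge0 => m _.
exact: mulr_ge0 (ltW (d_gt0 _ _)) (picone_defect_ge0 _ _ _).
Qed.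

(** Retaining a single defect is what allows equality to be exploited in the proof of
    non-attainability. *)
Lemma hardy_step_defect j u n k : (k < n)%N ->
  \sum_(m < n) hardy_weight j.+1 m * cabs (u m) `^ p +
    d j k * picone_defect j u k <=
  \sum_(m < n) hardy_weight j m * cabs (nab u m) `^ p.
Proof.
case: n => // n kn.
rewrite hardy_step_eq -addrA lerD2l.
rewrite (bigD1 (Ordinal kn))//= addrCA lerDl.
apply: addr_ge0.
  exact: mulr_ge0 (ltW (d_gt0 _ _)) (hardy_quotient_ge0 _ _ _).
apply: sumr_ge0 => m _.
exact: mulr_ge0 (ltW (d_gt0 _ _)) (picone_defect_ge0 _ _ _).
Qed.

Lemma hardy_weight0 m : hardy_weight 0 m = 1.
Proof. by rewrite /hardy_weight addr0 divff// gt_eqF// hardy_base_gt0. Qed.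

(** The comparison is between partial sums of equal length, hence covers sequences of infinite
    support as well. *)
Lemma hardy_chain l u n :
  \sum_(m < n) hardy_weight l m * cabs (u m) `^ p <=
  \sum_(m < n) cabs (iter l nab u m) `^ p.
Proof.
elim: l u => [|l IHl] u.
  by rewrite (eq_bigr _ (fun _ _ => congr1 ( *%R^~ _) (hardy_weight0 _))) /=
    (eq_bigr _ (fun _ _ => mul1r _)).
by apply: le_trans (hardy_step_ge _ _ _) _; rewrite iterSr; exact: IHl.
Qed.

End HardyChain.

(** * Test sequences with almost no deficit *)

Section HarmonicTails.
Variable R : realType.
Implicit Types (B c e : R) (n N : nat) (T : nat -> R).

Lemma harmonic_unbounded B : exists n, B < \sum_(m < n) (m.+1%:R : R)^-1.
Proof.
apply: contrapT => /forallNP H; apply: (@dvg_harmonic R).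
apply: nondecreasing_is_cvgn.
  apply/nondecreasing_seqP => n; rewrite !seriesEord /= big_ord_recr /= lerDl.
  exact: harmonic_ge0.
exists B => _ [n _ <-]; rewrite seriesEord /= leNgt; apply/negP; exact: H.
Qed.

(** Otherwise [T m > e / (c + m)] from rank [N] on, and the partial sums would dominate a multiple
    of the harmonic series. *)
Lemma liminf_mul_index T B c N e : 0 < c -> 0 < e -> (forall m, 0 <= T m) ->
  (forall n, \sum_(m < n) T m <= B) ->
  exists2 n, (N <= n)%N & (c + n%:R) * T n <= e.
Proof.
move=> c0 e0 T0 TB; apply: contrapT => H.
have c10 : 0 < c + 1 by rewrite addr_gt0.
have lowT m : (N <= m)%N -> e / (c + 1) / m.+1%:R <= T m.
  move=> Nm; have : e < (c + m%:R) * T m.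
    by rewrite ltNge; apply/negP => h; apply: H; exists m.
  move=> /ltW /le_trans h; rewrite -mulrA -invfM ler_pdivrMr ?mulr_gt0//.
  rewrite mulrC; apply: h; apply: ler_wpM2r => //.
  have : 0 <= c * m%:R by rewrite mulr_ge0// ltW.
  by rewrite -natr1; lra.
have [n] := harmonic_unbounded
  (B / (e / (c + 1)) + \sum_(m < N) (m.+1%:R : R)^-1).
have ec0 : 0 < e / (c + 1) by exact: divr_gt0.
apply/negP; rewrite -leNgt.
apply: (@le_trans _ _ (\sum_(m < N + n) (m.+1%:R : R)^-1)).
  rewrite addnC big_split_ord /= lerDl; apply: sumr_ge0 => i _.
  by rewrite invr_ge0.
rewrite big_split_ord /= addrC lerD2r ler_pdivlMr// mulr_suml.
apply: le_trans (TB (N + n)%N); rewrite big_split_ord /=.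
apply: ler_wpDl; first exact: sumr_ge0.
by apply: ler_sum => i _; rewrite mulrC; apply: lowT; exact: leq_addr.
Qed.

End HarmonicTails.

Section PerturbedOptimizer.
Variables (R : realType) (p : R).
Hypothesis p1 : 1 < p.
Implicit Types (a b c d e x M : R) (j k l m n N : nat).

Let s := 1 - p^-1.

Let p0 : 0 < p. Proof. exact: lt_trans p1. Qed.
Let s0 : 0 < s. Proof. by rewrite subr_gt0 invf_lt1. Qed.
Let s1 : s < 1. Proof. by rewrite gtrBl invr_gt0. Qed.

Lemma nab_rbin x : nab (rbin (x + 1)) = rbin x.
Proof. by apply/funext => -[|m] /=; rewrite ?rbin0// rbin_diff. Qed.

Lemma iter_nab_rbin x l : iter l nab (rbin (x + l%:R)) = rbin x.
Proof.
elim: l => [|l IHl]; first by rewrite addr0.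
by rewrite iterSr -natr1 addrA nab_rbin.
Qed.

(* With t = (c - b) / c the right-hand side is at least
   (1 - t) `^ (- p) * (1 - p t), by Bernoulli. *)
Let dilation_lower b c M : 0 < b -> b <= c -> 0 < M -> p * ((c - b) / c) <= 1 ->
  1 - (p * ((c - b) / c)) ^+ 2 <=
  ((b + M) / b) `^ p / ((c + M) / c) `^ (p - 1) -
  (M / b) `^ p / (M / c) `^ (p - 1).
Proof.
move=> b0 bc M0; set t := (c - b) / c => pt1.
have c0 : 0 < c by exact: lt_le_trans bc.
have cM0 : 0 < c + M by rewrite addr_gt0.
have bM0 : 0 < b + M by rewrite addr_gt0.
have bcp : (c / b) `^ p = (1 - t) `^ (- p).
  rewrite (_ : 1 - t = b / c); last by rewrite /t; field; rewrite gt_eqF.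
  have bc0 : 0 <= b / c by rewrite divr_ge0 ?(ltW b0) ?(ltW c0).
  by rewrite -invf_div -(powR_inv1 bc0) -powRrM mulN1r.
have -> : ((b + M) / b) `^ p / ((c + M) / c) `^ (p - 1) -
    (M / b) `^ p / (M / c) `^ (p - 1) =
    (c / b) `^ p * (((c + M) * ((b + M) / (c + M)) `^ p - M) / c).
  rewrite !powR_subr1 ?divr_gt0//.
  rewrite !powR_div//; field.
  by rewrite !powR_neq0// !gt_eqF.
rewrite bcp.
have t1 : t < 1 by rewrite ltr_pdivrMr// mul1r gtrBl.
have h1 := ler_1DM_powRN t1 p0.
have h2 : 1 - p * t <= ((c + M) * ((b + M) / (c + M)) `^ p - M) / c.
  have := @ler_bernoulli_powR _ ((b + M) / (c + M)) p
    (divr_ge0 (ltW bM0) (ltW cM0)) p1.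
  rewrite -(ler_pM2l cM0) => h; rewrite ler_pdivlMr// lerBrDr.
  by apply: le_trans h; rewrite le_eqVlt; apply/orP; left; apply/eqP;
    rewrite /t; field; rewrite !gt_eqF.
have -> : 1 - (p * t) ^+ 2 = (1 + p * t) * (1 - p * t) by ring.
apply: ler_pM => //; last by rewrite subr_ge0.
by rewrite addr_ge0// mulr_ge0 ?(ltW p0)// divr_ge0 ?subr_ge0 ?(ltW c0).
Qed.

Variable del : R.
Hypothesis del0 : 0 < del.
Hypothesis del1 : p * del <= s.

Let a := s - del.
Let e := p * del / s.

Let dels : del < s.
Proof. by apply: lt_le_trans del1; rewrite ltr_pMl. Qed.
Let a0 : 0 < a. Proof. by rewrite subr_gt0. Qed.
Let aj0 j : 0 < a + j%:R. Proof. by rewrite ltr_wpDr. Qed.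
Let sj0 j : 0 < s + j%:R. Proof. by rewrite ltr_wpDr. Qed.
Let e0 : 0 <= e.
Proof. by rewrite divr_ge0 ?mulr_ge0 ?(ltW p0) ?(ltW del0) ?(ltW s0). Qed.
Let e1 : e <= 1. Proof. by rewrite ler_pdivrMr// mul1r. Qed.

(** A telescoping bound. As [p s = p - 1], Bernoulli makes [(a + n) (rbin a n) ^ p] decrease by at
    least [p del (rbin a n.+1) ^ p] at each step. *)
Lemma sum_rbin_powR_le n :
  p * del * \sum_(m < n) rbin a m `^ p <= 2.
Proof.
case: n => [|n]; first by rewrite big_ord0 mulr0.
rewrite big_ord_recl /= rbin0 powR1 mulrDr mulr1.
have key : p * del * \sum_(i < n) rbin a (bump 0 i) `^ p +
    (a + n%:R) * rbin a n `^ p <= a.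
  elim: n => [|n IHn].
    by rewrite big_ord0 mulr0 add0r addr0 rbin0 powR1 mulr1.
  apply: le_trans IHn.
  rewrite big_ord_recr /= mulrDr -addrA lerD2l /bump/= add1n.
  have an0 : 0 < a + n%:R by exact: aj0.
  have r0 : 0 < n.+1%:R / (a + n%:R) by rewrite divr_gt0.
  have -> : rbin a n = rbin a n.+1 * (n.+1%:R / (a + n%:R)).
    by rewrite rbinS; field; rewrite gt_eqF//= pnatr_eq0.
  rewrite powRM ?rbin_ge0 ?(ltW r0)//.
  have := ler_bernoulli_powR (ltW r0) p1; rewrite -(ler_pM2l an0) => h.
  have c0 : 0 <= rbin a n.+1 `^ p by exact: powR_ge0.
  have := ler_wpM2l c0 h.
  have -> : (a + n%:R) * (1 + p * (n.+1%:R / (a + n%:R) - 1)) =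
      p * del + (a + n.+1%:R).
    have ps : p * s = p - 1 by rewrite /s mulrBr mulr1 divff// gt_eqF.
    have pa : p * a = p - 1 - p * del by rewrite /a mulrBr ps.
    transitivity (a + n%:R + p * (n.+1%:R - n%:R) - p * a).
      by field; rewrite gt_eqF.
    by rewrite pa -natr1; ring.
  move=> h'; rewrite -mulrDl mulrC (mulrC (a + n%:R)) -mulrA.
  by rewrite (mulrC (_ `^ p) (a + _)).
apply: (@le_trans _ _ (s + a)).
  apply: lerD => //; apply: le_trans key; rewrite lerDl.
  by rewrite mulr_ge0 ?powR_ge0 ?(ltW (aj0 _)).
rewrite /a; have := s1; have := del0; lra.
Qed.

Let d j := iter j dif (hardy_base p).
Let d_gt0 j m : 0 < d j m. Proof. exact: iter_dif_hardy_base_gt0. Qed.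

Let U j m : R[i] := (rbin (a + j%:R) m)%:C.

Let nabU j : nab (U j.+1) = U j.
Proof.
apply/funext => m; rewrite /U -(nab_rbin (a + j%:R)) -(addrA a) natr1.
by case: m => [|m] //=; rewrite rmorphB.
Qed.

Let cabsU j m : cabs (U j m) = rbin (a + j%:R) m.
Proof. by rewrite cabs_real ger0_norm// rbin_ge0. Qed.

(* The terms of the intermediate energies of the test sequence
   rbin (s - del + l), of which a backward difference lowers l. *)
Definition test_term j m : R :=
  hardy_weight p j m * rbin (s - del + j%:R) m `^ p.

Lemma test_term_ge0 j m : 0 <= test_term j m.
Proof. by rewrite mulr_ge0 ?powR_ge0// ltW// hardy_weight_gt0. Qed.

Lemma sum_test_term_le_base j n :
  \sum_(m < n) test_term j m <= \sum_(m < n) rbin a m `^ p.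
Proof.
have h : iter j nab (U j) = U 0.
  by elim: j => // j IHj; rewrite iterSr nabU.
have := hardy_chain p1 j (U j) n; rewrite h.
under eq_bigr do rewrite cabsU.
by under [X in _ <= X -> _]eq_bigr do rewrite cabsU addr0.
Qed.

Let quotientE j n : hardy_quotient p j (U j.+1) n =
  ((a + j%:R + n%:R) / (a + j%:R)) `^ p /
  ((s + j%:R + n%:R) / (s + j%:R)) `^ (p - 1) *
  (rbin (a + j%:R) n `^ p / rbin (s + j%:R) n `^ (p - 1)).
Proof.
have E x m : 0 < x -> rbin (x + 1) m = (x + m%:R) / x * rbin x m.
  by move=> x0; rewrite mulrAC -rbinD1 mulrC mulKf// gt_eqF.
have q x m : 0 < x -> 0 <= (x + m%:R) / x.
  by move=> x0; rewrite divr_ge0 ?addr_ge0 ?(ltW x0).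
rewrite /hardy_quotient cabsU -natr1 !addrA -/s (E _ _ (aj0 j)) (E _ _ (sj0 j)).
rewrite (powRM _ (q _ _ (aj0 j)) (rbin_ge0 _ (aj0 j))).
rewrite (powRM _ (q _ _ (sj0 j)) (rbin_ge0 _ (sj0 j))).
by rewrite invfM; ring.
Qed.

Let defect_le j m : picone_defect p j (U j.+1) m <=
  e ^+ 2 * (rbin (a + j%:R) m `^ p / rbin (s + j%:R) m `^ (p - 1)).
Proof.
rewrite /picone_defect nabU cabsU -/s; set w := _ / _.
have w0 : 0 <= w by rewrite divr_ge0 ?powR_ge0.
case: m @w w0 => [|m] w w0.
  rewrite /= /hardy_quotient /w cabsU !rbin0 subrr mulr_ge0//.
  by rewrite exprn_ge0.
rewrite lerBlDr -lerBlDl -[X in X - _]mul1r -mulrBl.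
have -> : nab (hardy_quotient p j (U j.+1)) m.+1 =
   (((a + j%:R + m.+1%:R) / (a + j%:R)) `^ p /
    ((s + j%:R + m.+1%:R) / (s + j%:R)) `^ (p - 1) -
    (m.+1%:R / (a + j%:R)) `^ p / (m.+1%:R / (s + j%:R)) `^ (p - 1)) * w.
  rewrite mulrBl /= [in LHS]quotientE; congr (_ - _).
  rewrite quotientE /w !rbinS.
  have an0 : 0 < a + j%:R + m%:R by rewrite ltr_wpDr.
  have sn0 : 0 < s + j%:R + m%:R by rewrite ltr_wpDr.
  rewrite !(powRM _ (rbin_ge0 _ _)) ?divr_ge0 ?(ltW an0) ?(ltW sn0)//.
  rewrite !powR_div ?pochhammer_gt0//.
  by field; rewrite !powR_neq0// pochhammer_gt0.
apply: ler_wpM2r => //.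
(* [dilation_lower] is used with [b = a + j], [c = s + j] and [M = m + 1], so that
   [t = del / (s + j)] is at most [del / s]. *)
have te : p * ((s + j%:R - (a + j%:R)) / (s + j%:R)) <= e.
  have -> : s + j%:R - (a + j%:R) = del by rewrite /a; ring.
  rewrite mulrA /e ler_pM2l ?mulr_gt0// lef_pV2 ?posrE//.
  by rewrite lerDl.
apply: le_trans (dilation_lower (aj0 j) _ _ _) => //.
- rewrite lerD2l lerN2 ler_sqr ?nnegrE//.
  rewrite mulr_ge0 ?(ltW p0)// divr_ge0 ?(ltW (sj0 _))//.
  by rewrite subr_ge0 lerD2r gerBl ltW.
- by rewrite lerD2r gerBl ltW.
- exact: le_trans e1.
Qed.

(** This puts the boundary term in the form [(c + n) T n] with [T] summable, which
    [liminf_mul_index] makes small along some indices. *)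
Let boundary_le j n : d j n.+1 * hardy_quotient p j (U j.+1) n <=
  (s + j%:R) `^ (p - 1) / (a + j%:R) `^ p * ((a + j%:R + n%:R) * test_term j n).
Proof.
have an0 : 0 < a + j%:R + n%:R by rewrite ltr_wpDr.
have sn0 : 0 < s + j%:R + n%:R by rewrite ltr_wpDr.
set K := _ / _; have K0 : 0 <= K by rewrite divr_ge0 ?powR_ge0.
have ddec : d j n.+1 <= d j n.
  by rewrite -subr_ge0 ltW//; exact: (iter_dif_hardy_base_gt0 p1 j.+1 n).
apply: (@le_trans _ _ (d j n * hardy_quotient p j (U j.+1) n)).
  by apply: ler_wpM2r => //; exact: hardy_quotient_ge0.
rewrite quotientE /test_term /hardy_weight -/(d j) -/s -/a.
set w := rbin (s + j%:R) n `^ _; set z := rbin (a + j%:R) n `^ _.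
have -> : K * ((a + j%:R + n%:R) * (d j n / w * z)) =
  d j n * (K * (a + j%:R + n%:R) * (z / w)) by ring.
rewrite ler_pM2l//; apply: ler_wpM2r; first by rewrite divr_ge0 ?powR_ge0.
rewrite !powR_div//.
have -> : (a + j%:R + n%:R) `^ p / (a + j%:R) `^ p /
    ((s + j%:R + n%:R) `^ (p - 1) / (s + j%:R) `^ (p - 1)) =
    K * ((a + j%:R + n%:R) `^ p / (s + j%:R + n%:R) `^ (p - 1)).
  by rewrite /K; field; rewrite !powR_neq0.
apply: ler_wpM2l => //.
rewrite ler_pdivrMr ?powR_gt0//.
rewrite -(@mulr_powRB1 _ (a + j%:R + n%:R)) ?(ltW an0)//.
rewrite ler_pM2l//.
apply: ge0_ler_powR; rewrite ?nnegrE ?(ltW an0) ?(ltW sn0)//.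
  by rewrite subr_ge0 ltW.
by rewrite !lerD2r gerBl ltW.
Qed.

(** One Hardy step read backwards: the defects cost the factor [1 - e ^ 2], and the truncation index
    is chosen where the boundary term is at most [eps]. *)
Let step_reverse j n eps : 0 < eps -> exists2 n', (n <= n')%N &
  (1 - e ^+ 2) * \sum_(m < n') test_term j m <=
  \sum_(m < n') test_term j.+1 m + eps.
Proof.
move=> eps0; set K := (s + j%:R) `^ (p - 1) / (a + j%:R) `^ p.
have K0 : 0 < K by rewrite divr_gt0 ?powR_gt0.
have base n0 : \sum_(m < n0) test_term j m <= 2 / (p * del).
  apply: le_trans (sum_test_term_le_base j n0) _.
  by rewrite ler_pdivlMr ?mulr_gt0// mulrC sum_rbin_powR_le.
have [m nm hm] := liminf_mul_index n (aj0 j) (divr_gt0 eps0 K0)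
  (test_term_ge0 j) base.
exists m.+1; first exact: leqW.
have := hardy_step_eq p j (U j.+1) m; rewrite nabU.
under eq_bigr do rewrite cabsU -/(test_term _ _).
under [X in _ = X + _ + _]eq_bigr do rewrite cabsU -/(test_term _ _).
rewrite -/(d j) => E.
have D : \sum_(i < m.+1) d j i * picone_defect p j (U j.+1) i <=
    e ^+ 2 * \sum_(i < m.+1) test_term j i.
  rewrite mulr_sumr; apply: ler_sum => i _.
  apply: le_trans (ler_wpM2l (ltW (d_gt0 j i)) (defect_le j i)) _.
  rewrite le_eqVlt; apply/orP; left; apply/eqP.
  by rewrite /test_term /hardy_weight -/(d j) -/s -/a; ring.
have Bd : d j m.+1 * hardy_quotient p j (U j.+1) m <= eps.
  apply: le_trans (boundary_le j m) _; rewrite -/K mulrC -ler_pdivlMr//.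
rewrite mulrBl mul1r lerBlDr {1}E.
by apply: lerD => //; rewrite lerD2l.
Qed.

(* Along the test sequence the Hardy chain loses only a factor 1 - O(del ^ 2) at
   each step; since the energy is O(1 / del), the total deficit is O(del). *)
Lemma test_term_reverse j n eps : 0 < eps -> exists2 n', (n <= n')%N &
  (1 - (p * del / s) ^+ 2) ^+ j * \sum_(m < n) test_term 0 m <=
  \sum_(m < n') test_term j m + eps.
Proof.
have c0 : 0 <= 1 - e ^+ 2 by rewrite subr_ge0 expr_le1.
have c1 : 1 - e ^+ 2 <= 1 by rewrite gerBl exprn_ge0.
elim: j n eps => [|j IHj] n eps eps0.
  by exists n => //; rewrite expr0 mul1r lerDl ltW.
have eps20 : 0 < eps / 2 by rewrite divr_gt0.
have [m nm hm] := IHj n _ eps20.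
have [k mk hk] := step_reverse j m eps20.
exists k; first exact: leq_trans mk.
rewrite exprS -mulrA; apply: le_trans (ler_wpM2l c0 hm) _.
rewrite mulrDr [X in _ <= _ + X](splitr eps) addrA.
apply: lerD; last by rewrite ler_piMl// ltW.
apply: le_trans hk; apply: ler_wpM2l => //.
rewrite -(subnKC mk) big_split_ord /= lerDl.
by apply: sumr_ge0 => i _; exact: test_term_ge0.
Qed.

End PerturbedOptimizer.

(** * Polynomial cutoffs *)

Section IteratedBackwardDifference.
Variable R : realType.
Implicit Types (u v : nat -> R) (B : R) (k m n : nat).

Lemma nabB u v : nab (fun m => u m - v m) = (fun m => nab u m - nab v m).
Proof. by apply/funext => -[|m] //=; ring. Qed.

Lemma iter_nabB k u v m :
  iter k nab (fun m => u m - v m) m = iter k nab u m - iter k nab v m.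
Proof. by elim: k u v => [|k IHk] u v //; rewrite !iterSr nabB IHk. Qed.

Lemma iter_nabZ k c u m : iter k nab (fun m => c * u m) m = c * iter k nab u m.
Proof.
elim: k u => [|k IHk] u //; rewrite !iterSr -IHk.
by congr (iter k nab _ m); apply/funext => -[|i] //=; rewrite mulrBr.
Qed.

Lemma iter_nab_le k u B m : (forall i, (i <= m)%N -> `|u i| <= B) ->
  `|iter k nab u m| <= 2 ^+ k * B.
Proof.
elim: k u B => [|k IHk] u B uB; first by rewrite mul1r uB.
rewrite iterSr exprSr -mulrA; apply: IHk => -[|i] im /=.
  apply: le_trans (uB _ im) _.
  by rewrite ler_peMl ?ler1n// (le_trans _ (uB _ im)).
apply: le_trans (ler_normB _ _) _.
by rewrite mulr_natl mulr2n lerD ?uB// ltnW.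
Qed.

Lemma eq_iter_nab_tail k u v m n : (n + k <= m)%N ->
  (forall i, (n <= i)%N -> u i = v i) -> iter k nab u m = iter k nab v m.
Proof.
elim: k u v n => [|k IHk] u v n; first by rewrite addn0 => nm; exact.
move=> nkm uv; rewrite !iterSr; apply: (IHk _ _ n.+1); first by rewrite addSnnS.
by case=> // i ni /=; rewrite !uv// leqW.
Qed.

Lemma iter_nab_real k u m :
  iter k nab (fun m => (u m)%:C) m = (iter k nab u m)%:C.
Proof.
elim: k u => [|k IHk] u //; rewrite !iterSr -IHk.
by congr (iter k nab _ m); apply/funext => -[|i] //=; rewrite rmorphB.
Qed.

Lemma nonneg_series_tail (T : nat -> R) B e J0 : 0 < e ->
  (forall m, 0 <= T m) -> (forall n, \sum_(m < n) T m <= B) ->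
  exists2 J, (J0 <= J)%N & forall n, \sum_(m < n) T (J + m)%N <= e.
Proof.
move=> e0 T0 TB; pose S : set R := range (fun n => \sum_(m < n) T m).
have supS : has_sup S.
  split; first by exists (\sum_(m < 0) T m), 0%N.
  by exists B => _ [n _ <-].
have [_ [J _ <-] hJ] := sup_adherent e0 supS.
exists (maxn J0 J); first exact: leq_maxl.
move=> n; have : \sum_(m < maxn J0 J + n) T m <= sup S.
  by apply: (ub_le_sup (proj2 supS)); exists (maxn J0 J + n)%N.
rewrite big_split_ord /= => h.
have : \sum_(m < J) T m <= \sum_(m < maxn J0 J) T m.
  rewrite -(subnKC (leq_maxr J0 J)) big_split_ord /= lerDl.
  exact: sumr_ge0.
by move: h hJ; lra.
Qed.

End IteratedBackwardDifference.

Section Cutoff.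
Variable R : realType.
Implicit Types (x y : R) (i j k m n r M N : nat).

(* Truncated subtraction makes 'C(N - m, r) vanish for m > N - r, and its
   backward difference is - 'C(N - m, r.-1) as long as r > 1. *)
Definition cut N y i r m : R :=
  (if (i <= m)%N then rbin y (m - i) else 0) * 'C(N - m, r)%:R.

Lemma bin_subn_pred N m r : (1 < r)%N ->
  'C(N - m, r) = ('C(N - m.+1, r) + 'C(N - m.+1, r.-1))%N.
Proof.
case: r => [|[|r]] // _; rewrite subnS.
by case: (N - m)%N => [|k] //=; rewrite ?bin0n// binS.
Qed.

(** The product rule: a difference either lowers [y + 1] or falls on the binomial. Both terms have
    the shape [cut] with the same [i + r]. *)
Lemma nab_cut N y i r : (1 < r)%N ->
  nab (cut N (y + 1) i r) =
  (fun m => cut N y i r m - cut N (y + 1) i.+1 r.-1 m).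
Proof.
move=> r1; apply/funext => -[|m]; rewrite /cut /=.
  rewrite mul0r subr0 sub0n; case: ifP => // _.
  by rewrite !rbin0.
rewrite (bin_subn_pred N m r1) natrD ltnS subSS.
have [im|mi] := leqP i m.
  rewrite (leqW im) subSn// -(rbin_diff y); ring.
have [->|iN] := eqVneq i m.+1.
  by rewrite leqnn subnn !rbin0 !mul0r.
rewrite leq_eqVlt (negbTE iN) ltnS leqNgt mi /= !mul0r; ring.
Qed.

(** After [i] differences have fallen on the binomial the parameter is still [x + i]; this brings it
    back to a multiple of [rbin x m]. *)
Lemma rbinD_bin x m i : 0 < x ->
  (if (i <= m)%N then rbin (x + i%:R) (m - i) else 0) =
  rbin x m * 'C(m, i)%:R / rbin x i.
Proof.
move=> x0; case: leqP => [im|mi]; last by rewrite bin_small// mulr0 mul0r.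
have px : pochhammer x m = pochhammer x i * pochhammer (x + i%:R) (m - i).
  by rewrite -pochhammerD subnKC.
rewrite /rbin px.
have -> : (m`!%:R : R) = 'C(m, i)%:R * (i`!%:R * (m - i)`!%:R).
  by rewrite -!natrM bin_fact.
have p0 := pochhammer_gt0 i x0.
have f0 k : (k`!%:R : R) != 0 by rewrite pnatr_eq0 -lt0n fact_gt0.
have b0 : ('C(m, i)%:R : R) != 0 by rewrite pnatr_eq0 -lt0n bin_gt0.
by field; rewrite !f0 b0 gt_eqF.
Qed.

(** The left-hand side is one term of Vandermonde's sum when [m <= N], and vanishes otherwise
    because [r > 0]. *)
Lemma bin_mul_le N M i r m : (i + r)%N = M -> (0 < r)%N ->
  ('C(m, i) * 'C(N - m, r) <= 'C(N, M))%N.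
Proof.
move=> <- r0; have [mN|Nm] := leqP m N; last first.
  rewrite (_ : (N - m)%N = 0%N) ?bin0n ?gtn_eqF ?muln0//.
  by apply/eqP; rewrite subn_eq0 ltnW.
rewrite -[in leqRHS](subnKC mN) -binomial.Vandermonde.
have ir : (i < (i + r).+1)%N by rewrite ltnS leq_addr.
by rewrite (bigD1 (Ordinal ir))//= addKn leq_addr.
Qed.

(** Each difference doubles the number of terms, whence [2 ^ k]; the sum over [j] is a common bound
    for the factors [1 / rbin x i]. The hypothesis [k < r] keeps [nab_cut] applicable at every
    stage. *)
Lemma iter_nab_cut_le N M x k i r m : 0 < x -> (i + r)%N = M -> (k < r)%N ->
  `|iter k nab (cut N (x + i%:R + k%:R) i r) m| <=
  2 ^+ k * (\sum_(j < M.+1) (rbin x j)^-1) * rbin x m * 'C(N, M)%:R.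
Proof.
move=> x0; elim: k i r => [|k IHk] i r irM kr.
  rewrite /= addr0 /cut rbinD_bin// expr0 mul1r.
  have iM : (i < M.+1)%N by rewrite ltnS -irM leq_addr.
  rewrite ger0_norm; last first.
    by rewrite mulr_ge0// divr_ge0 ?(rbin_ge0 _ x0)// mulr_ge0 ?rbin_ge0.
  have -> : rbin x m * 'C(m, i)%:R / rbin x i * 'C(N - m, r)%:R =
    (rbin x i)^-1 * rbin x m * ('C(m, i)%:R * 'C(N - m, r)%:R) by ring.
  apply: ler_pM => //.
  - by rewrite mulr_ge0 ?invr_ge0 ?rbin_ge0.
  - rewrite ler_pM2r ?rbin_gt0// (bigD1 (Ordinal iM))//= lerDl.
    by apply: sumr_ge0 => j _; rewrite invr_ge0 rbin_ge0.
  - by rewrite -natrM ler_nat; exact: bin_mul_le.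
have r1 : (1 < r)%N by apply: leq_ltn_trans kr.
rewrite iterSr -natr1 addrA nab_cut// iter_nabB.
apply: le_trans (ler_normB _ _) _.
have h1 := IHk i r irM (ltnW kr).
have h2 : (i.+1 + r.-1)%N = M by rewrite addSnnS prednK// ltnW.
have h3 : (k < r.-1)%N by rewrite -ltnS prednK// ltnW.
have := IHk i.+1 r.-1 h2 h3.
have -> : x + i.+1%:R + k%:R = x + i%:R + k%:R + 1 by rewrite -natr1; ring.
by move: h1; rewrite exprS; lra.
Qed.

Definition cutoff N M m : R := 'C(N - m, M)%:R / 'C(N, M)%:R.

Lemma cutoff_le1 N M m : (M <= N)%N -> cutoff N M m <= 1.
Proof.
move=> MN; rewrite ler_pdivrMr ?ltr0n ?bin_gt0// mul1r ler_nat.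
by apply: leq_bin2l; exact: leq_subr.
Qed.

Lemma cutoff_eq0 N M m : (0 < M)%N -> (N <= m)%N -> cutoff N M m = 0.
Proof.
move=> M0; rewrite -subn_eq0 /cutoff => /eqP ->.
by rewrite bin0n gtn_eqF// mul0r.
Qed.

Lemma iter_nab_cutoff_le N M x k m : 0 < x -> (k < M)%N -> (M <= N)%N ->
  `|iter k nab (fun m => rbin (x + k%:R) m * cutoff N M m) m| <=
  2 ^+ k * (\sum_(j < M.+1) (rbin x j)^-1) * rbin x m.
Proof.
move=> x0 kM MN.
have C0 : 0 < 'C(N, M)%:R :> R by rewrite ltr0n bin_gt0.
have -> : (fun m => rbin (x + k%:R) m * cutoff N M m) =
    (fun m => ('C(N, M)%:R)^-1 * cut N (x + 0%:R + k%:R) 0 M m).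
  by apply/funext => n; rewrite /cut /cutoff leq0n subn0 addr0; ring.
rewrite iter_nabZ normrM ger0_norm ?invr_ge0// mulrC ler_pdivrMr//.
exact: iter_nab_cut_le.
Qed.

(** Each unit increase of [m] costs at most ['C(N, M)], and ['C(N, M) / 'C(N, M.+1)] is
    [(M + 1) / (N - M)]. *)
Lemma cutoff_near1 N M m : (M.+1 <= N)%N ->
  1 - cutoff N M.+1 m <= (m * M.+1)%:R / (N - M)%:R.
Proof.
move=> MN; have C0 : 0 < 'C(N, M.+1)%:R :> R by rewrite ltr0n bin_gt0.
have NM0 : 0 < (N - M)%:R :> R by rewrite ltr0n subn_gt0.
have h : ('C(N, M.+1) <= 'C(N - m, M.+1) + m * 'C(N, M))%N.
  elim: m => [|m IHm]; first by rewrite subn0 mul0n addn0.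
  apply: leq_trans IHm _; rewrite mulSn addnA leq_add2r subnS.
  case E: (N - m)%N => [|k] /=; first by rewrite leq_addr.
  rewrite binS leq_add2l; apply: leq_bin2l.
  by apply: leq_trans (leq_subr m N); rewrite E.
have h2 : (M.+1 * 'C(N, M.+1))%N = ((N - M) * 'C(N, M))%N.
  exact: mul_bin_left.
have -> : 1 - cutoff N M.+1 m =
    ('C(N, M.+1)%:R - 'C(N - m, M.+1)%:R) / 'C(N, M.+1)%:R.
  by rewrite /cutoff mulrBl divff// gt_eqF.
rewrite ler_pdivrMr// mulrAC ler_pdivlMr//.
rewrite -[X in _ <= X]natrM -mulnA h2 mulnCA natrM mulrC ler_pM2l//.
by rewrite lerBlDl -natrD ler_nat.
Qed.

End Cutoff.

(** * Approximation of test sequences by finitely supported ones *)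

Section FinitelySupportedApproximation.
Variables (R : realType) (p : R).
Hypothesis p1 : 1 < p.
Implicit Types (a x y B e eta : R) (l m n J K N : nat).

Let p0 : 0 < p. Proof. exact: lt_trans p1. Qed.

(** The tangent line at [x + y], obtained from Bernoulli at [x / (x + y)]. *)
Lemma powRD_le x y B : 0 <= x -> x <= B -> 0 < y -> y <= 1 ->
  (x + y) `^ p <= x `^ p + p * (B + 1) `^ (p - 1) * y.
Proof.
move=> x0 xB y0 y1; have xy0 : 0 < x + y by rewrite ltr_wpDl.
have := @ler_bernoulli_powR _ (x / (x + y)) p (divr_ge0 x0 (ltW xy0)) p1.
have q0 : 0 < (x + y) `^ p by rewrite powR_gt0.
rewrite -(ler_pM2l q0).
have -> : (x + y) `^ p * (x / (x + y)) `^ p = x `^ p.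
  by rewrite -powRM ?divr_ge0 ?(ltW xy0)// mulrC divfK// gt_eqF.
have -> : (x + y) `^ p * (1 + p * (x / (x + y) - 1)) =
    (x + y) `^ p - p * (x + y) `^ (p - 1) * y.
  by rewrite powR_subr1//; field; rewrite gt_eqF.
rewrite lerBlDr => /le_trans; apply; rewrite lerD2l ler_pM2r// ler_pM2l//.
apply: ge0_ler_powR; rewrite ?nnegrE ?(ltW xy0)//.
- by rewrite subr_ge0 ltW.
- by rewrite addr_ge0// (le_trans x0).
- exact: lerD.
Qed.

Lemma ler_1BM_powR e x : 0 <= e -> e <= 1 -> 0 <= x ->
  (1 - p * e) * x `^ p <= ((1 - e) * x) `^ p.
Proof.
move=> e0 e1 x0; have e10 : 0 <= 1 - e by rewrite subr_ge0.
rewrite powRM//; apply: ler_wpM2r; first exact: powR_ge0.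
have := ler_bernoulli_powR e10 p1; congr (_ <= _).
by ring.
Qed.

Definition truncated_test a l m0 m : R :=
  if (m < m0)%N then 0 else rbin (a + l%:R) m.

Lemma truncated_test_ge0 a l m0 m : 0 < a -> 0 <= truncated_test a l m0 m.
Proof.
by rewrite /truncated_test; case: ifP => // _ a0; rewrite rbin_ge0// ltr_wpDr.
Qed.

(** The witness is the truncated sequence times a cutoff of length [N]. A rank [J] is fixed first,
    beyond which the energy is small uniformly in [N]; then [N] is taken so large that the cutoff is
    nearly 1 before [J + K]. *)
Lemma finite_support_approx a l m0 B K eta : 0 < a -> 0 < eta ->
  (forall n, \sum_(m < n) rbin a m `^ p <= B) ->
  exists v : nat -> R,
    [/\ exists N, forall m, (N <= m)%N -> v m = 0,
        forall m, (m < m0)%N -> v m = 0,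
        forall m, (m < K)%N ->
          (1 - eta) * truncated_test a l m0 m <= v m
      & exists J, forall n, \sum_(m < n) `|iter l nab v m| `^ p <=
          \sum_(m < J) `|iter l nab (truncated_test a l m0) m| `^ p + eta].
Proof.
move=> a0 eta0 aB; set z := truncated_test a l m0.
have z0 m : 0 <= z m by exact: truncated_test_ge0.
(* The constant of [iter_nab_cutoff_le] for [k = l] and [M = l + 1]. *)
set C : R := 2 ^+ l * \sum_(j < l.+2) (rbin a j)^-1.
have C0 : 0 <= C.
  by rewrite mulr_ge0 ?exprn_ge0// sumr_ge0// => j _; rewrite invr_ge0 rbin_ge0.
have T0 m : 0 <= (C * rbin a m) `^ p by exact: powR_ge0.
have TB n : \sum_(m < n) (C * rbin a m) `^ p <= C `^ p * B.
  under eq_bigr do rewrite powRM ?rbin_ge0//.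
  by rewrite -mulr_sumr; apply: ler_wpM2l => //; exact: powR_ge0.
have eta20 : 0 < eta / 2 by rewrite divr_gt0.
have [J m0J tailJ] := nonneg_series_tail (m0 + l) eta20 T0 TB.
set Z : R := \sum_(i < J + K) rbin (a + l%:R) i.
have al0 : 0 < a + l%:R by rewrite ltr_wpDr.
have zZ i : (i < J + K)%N -> z i <= Z.
  move=> iJK; have Z0 : 0 <= Z by apply: sumr_ge0 => j _; exact: rbin_ge0.
  rewrite /z /truncated_test; case: ifP => // _.
  rewrite /Z (bigD1 (Ordinal iJK))//= lerDl.
  by apply: sumr_ge0 => j _; exact: rbin_ge0.
have Z0 : 0 <= Z by apply: sumr_ge0 => j _; exact: rbin_ge0.
set B1 : R := 2 ^+ l * Z.
have B10 : 0 <= B1 by rewrite mulr_ge0 ?exprn_ge0.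
(* The head has [J] terms; [powRD_le] gives the Lipschitz constant, and [l] differences amplify an
   error by [2 ^ l]. *)
set X : R := J%:R * (p * (B1 + 1) `^ (p - 1) * 2 ^+ l).
have X0 : 0 <= X by rewrite mulr_ge0// !mulr_ge0 ?powR_ge0 ?exprn_ge0// ltW.
(* Dividing by [D] secures both [2 ^ l e1 <= 1] and [X e1 <= eta / 2]. *)
set D : R := 1 + 2 ^+ l + 2 * X.
have l20 : 0 < 2 ^+ l :> R by rewrite exprn_gt0.
have D0 : 0 < D by rewrite /D; lra.
set e1 : R := Num.min 1 eta / D.
have mn0 : 0 < Num.min 1 eta by rewrite lt_min ltr01.
have e10 : 0 < e1 by rewrite divr_gt0.
have e1l : 2 ^+ l * e1 <= 1.
  rewrite /e1 mulrA ler_pdivrMr// mul1r.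
  apply: (@le_trans _ _ (2 ^+ l * 1)).
    by rewrite ler_pM2l// ge_min lexx.
  by rewrite /D; lra.
have e1X : X * e1 <= eta / 2.
  rewrite /e1 mulrA ler_pdivrMr//.
  have h : X * Num.min 1 eta <= X * eta.
    by apply: ler_wpM2l => //; rewrite ge_min lexx orbT.
  have : 0 <= eta * 2 ^+ l by rewrite mulr_ge0 ?(ltW eta0) ?(ltW l20).
  by move: h; rewrite /D; lra.
(* With [N - l > Q], [cutoff_near1] bounds the error of the cutoff before [J + K]. *)
set Q : R := (Z + 1) * ((J + K) * l.+1)%:R / Num.min e1 eta.
have me0 : 0 < Num.min e1 eta by rewrite lt_min e10.
set N := (l.+1 + Num.truncn Q)%N.
have NQ : Q < (N - l)%:R by rewrite /N addSnnS addKn truncnS_gt.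
have Nl : (l.+1 <= N)%N by exact: leq_addr.
have near m : (m < J + K)%N ->
    (Z + 1) * (1 - cutoff R N l.+1 m) <= Num.min e1 eta.
  move=> mJK; have Z10 : 0 < Z + 1 by rewrite ltr_wpDl.
  apply: le_trans (ler_wpM2l (ltW Z10) (cutoff_near1 _ _ Nl)) _.
  have Nl0 : 0 < (N - l)%:R :> R by rewrite ltr0n subn_gt0.
  rewrite mulrA ler_pdivrMr// mulrC.
  apply: le_trans (_ : Num.min e1 eta * Q <= _); last by rewrite ler_pM2l// ltW.
  rewrite /Q mulrCA divff ?gt_eqF// mulr1 mulrC ler_pM2l// ler_nat.
  by rewrite leq_mul2r ltnW.
pose v m := z m * cutoff R N l.+1 m.
have c1 m : 0 <= 1 - cutoff R N l.+1 m by rewrite subr_ge0 cutoff_le1.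
exists v; split.
- by exists N => m Nm; rewrite /v cutoff_eq0// mulr0.
- by move=> m mm0; rewrite /v /z /truncated_test mm0 mul0r.
- move=> m mK; rewrite mulrC; apply: ler_wpM2l; first exact: z0.
  rewrite lerBlDr -lerBlDl; have mJK := leq_trans mK (leq_addl J K).
  have h : 1 - cutoff R N l.+1 m <= (Z + 1) * (1 - cutoff R N l.+1 m).
    by rewrite ler_peMl// lerDr.
  apply: le_trans h _; apply: le_trans (near _ mJK) _.
  by rewrite ge_min lexx orbT.
exists J => n.
(* Since [J >= m0 + l], the differences from [J] on do not see the truncation at [m0]. *)
have tail m : (J <= m)%N -> `|iter l nab v m| `^ p <= (C * rbin a m) `^ p.
  have Cr m' : 0 <= C * rbin a m' := mulr_ge0 C0 (rbin_ge0 m' a0).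
  move=> Jm; apply: ge0_ler_powR; rewrite ?nnegrE ?Cr ?(ltW p0)//.
  rewrite (@eq_iter_nab_tail _ l v
    (fun m => rbin (a + l%:R) m * cutoff R N l.+1 m) m m0).
  - exact: iter_nab_cutoff_le.
  - exact: leq_trans Jm.
  - by move=> i m0i; rewrite /v /z /truncated_test ltnNge m0i.
have head m : (m < J)%N -> `|iter l nab v m| `^ p <=
    `|iter l nab z m| `^ p + p * (B1 + 1) `^ (p - 1) * (2 ^+ l * e1).
  move=> mJ; have ltJK i : (i <= m)%N -> (i < J + K)%N.
    by move=> im; rewrite (leq_trans _ (leq_addr K J))// (leq_ltn_trans im).
  have y0 : 0 < 2 ^+ l * e1 by rewrite mulr_gt0.
  apply: le_trans (powRD_le (normr_ge0 _) _ y0 e1l); last first.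
    by apply: iter_nab_le => i /ltJK /zZ; rewrite ger0_norm.
  apply: ge0_ler_powR; rewrite ?nnegrE ?addr_ge0 ?(ltW p0) ?(ltW y0)//.
  rewrite -lerBlDl; apply: le_trans (lerB_dist _ _) _.
  rewrite distrC -iter_nabB; apply: iter_nab_le => i im.
  have -> : z i - v i = z i * (1 - cutoff R N l.+1 i) by rewrite /v; ring.
  rewrite ger0_norm ?mulr_ge0//.
  apply: le_trans (_ : (Z + 1) * (1 - cutoff R N l.+1 i) <= _).
    by apply: ler_wpM2r => //; rewrite (le_trans (zZ _ (ltJK _ im)))// lerDl.
  by apply: le_trans (near _ (ltJK _ im)) _; rewrite ge_min lexx.
apply: (@le_trans _ _ (\sum_(m < J + n) `|iter l nab v m| `^ p)).
  by rewrite addnC big_split_ord /= lerDl sumr_ge0// => i _; exact: powR_ge0.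
rewrite big_split_ord /= (splitr eta) addrA; apply: lerD; last first.
  apply: le_trans (tailJ n); apply: ler_sum => i _; apply: tail.
  exact: leq_addr.
apply: (@le_trans _ _ (\sum_(m < J) (`|iter l nab z m| `^ p +
    p * (B1 + 1) `^ (p - 1) * (2 ^+ l * e1)))).
  by apply: ler_sum => i _; exact: head.
rewrite big_split /= lerD2l sumr_const card_ord -[leLHS]mulr_natl.
apply: le_trans _ e1X; rewrite le_eqVlt; apply/orP; left; apply/eqP.
by rewrite /X; ring.
Qed.

End FinitelySupportedApproximation.

(** * Lower bound, criticality and optimality of the weight *)

Section HardyWeightOptimality.
Variables (R : realType) (p : R).
Hypothesis p1 : 1 < p.
Implicit Types (a B e eta : R) (l m n J K N : nat) (v w : nat -> R).

Let s := 1 - p^-1.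

Let p0 : 0 < p. Proof. exact: lt_trans p1. Qed.
Let s0 : 0 < s. Proof. by rewrite subr_gt0 invf_lt1. Qed.
Let s1 : s < 1. Proof. by rewrite gtrBl invr_gt0. Qed.

Lemma rbin_addl l m : rbin (s + l%:R) m =
  rbin s (m + l) * ((m + l)`!%:R / (pochhammer s l * m`!%:R)).
Proof.
rewrite /rbin addnC pochhammerD.
have p0' := pochhammer_gt0 l s0.
have f0 k : (k`!%:R : R) != 0 by rewrite pnatr_eq0 -lt0n fact_gt0.
by field; rewrite !f0 gt_eqF.
Qed.

(** Put [x = (s)_l m! / (m + l)!]. By [rbin_addl] the quotient of [hardy_base (m + l)] by
    [rbin (s + l) m ^ (p - 1)] is [x ^ (p - 1)], and the bound on the differences supplies another
    factor [x]. *)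
Lemma lt_hardy_weight l m : (0 < l)%N ->
  pochhammer s l `^ p * (m`!%:R / (m + l)`!%:R) `^ p < hardy_weight p l m.
Proof.
move=> l0; have sl0 : 0 < s + l%:R by rewrite ltr_wpDr.
rewrite /hardy_weight ltr_pdivlMr ?powR_gt0 ?(rbin_gt0 _ sl0)//.
apply: le_lt_trans (lt_iter_dif_hardy_base p1 m l0).
have A0 : 0 < pochhammer s l by exact: pochhammer_gt0.
have F0 : 0 < m`!%:R / (m + l)`!%:R :> R by rewrite divr_gt0// ltr0n fact_gt0.
rewrite -/s rbin_addl powRM ?rbin_ge0//; last first.
  by rewrite divr_ge0// mulr_ge0// ltW.
have -> : (m + l)`!%:R / (pochhammer s l * m`!%:R) =
    (pochhammer s l * (m`!%:R / (m + l)`!%:R))^-1.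
  by rewrite mulrA invf_div.
have AF0 : 0 < pochhammer s l * (m`!%:R / (m + l)`!%:R) by exact: mulr_gt0.
rewrite -powRM ?(ltW A0) ?(ltW F0)//.
rewrite -[(pochhammer s l * _)^-1](powR_inv1 (ltW AF0)) powRAC.
rewrite powR_inv1 ?powR_ge0// (powR_subr1 _ AF0) /hardy_base -/s.
rewrite le_eqVlt; apply/orP; left; apply/eqP.
have ne0 : (pochhammer s l * (m`!%:R / (m + l)`!%:R)) `^ p != 0.
  by rewrite gt_eqF ?powR_gt0.
move: ne0 (lt0r_neq0 AF0); set x := pochhammer s l * _ => xp x0.
by field; rewrite x0 xp.
Qed.

Lemma hardy_weight_optimizer_ge l m : (0 < l)%N ->
  rbin s (m + l) `^ p <= hardy_weight p l m * rbin (s + l%:R) m `^ p.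
Proof.
move=> l0; have A0 : 0 < pochhammer s l by exact: pochhammer_gt0.
have F0 : 0 < m`!%:R / (m + l)`!%:R :> R by rewrite divr_gt0// ltr0n fact_gt0.
have g0 : 0 < rbin (s + l%:R) m by rewrite rbin_gt0// ltr_wpDr.
apply: le_trans (ler_wpM2r (powR_ge0 _ _) (ltW (lt_hardy_weight m l0))).
have AF0 : 0 < pochhammer s l * (m`!%:R / (m + l)`!%:R) by exact: mulr_gt0.
rewrite -(powRM _ (ltW A0) (ltW F0)) -(powRM _ (ltW AF0) (ltW g0)) rbin_addl.
rewrite le_eqVlt; apply/orP; left; apply/eqP; congr (_ `^ p).
have f0 k : (k`!%:R : R) != 0 by rewrite pnatr_eq0 -lt0n fact_gt0.
by field; rewrite !f0 gt_eqF.
Qed.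

Lemma fact_le_expn l m : ((m + l)`! <= m`! * (m + l) ^ l)%N.
Proof.
have : forall k n, (m + k <= n)%N -> ((m + k)`! <= m`! * n ^ k)%N.
  elim=> [|k IHk] n mkn; first by rewrite addn0 muln1.
  rewrite addnS factS expnS mulnCA leq_mul// -?addnS//.
  by apply: IHk; rewrite (leq_trans _ mkn)// addnS.
by apply.
Qed.

Lemma lt_hardy_weight_powR l m : (0 < l)%N ->
  pochhammer s l `^ p / (m + l)%:R `^ (l%:R * p) < hardy_weight p l m.
Proof.
move=> l0; apply: le_lt_trans (lt_hardy_weight m l0).
apply: ler_wpM2l; first exact: powR_ge0.
have ml0 : 0 < (m + l)%:R :> R by rewrite ltr0n addn_gt0 l0 orbT.
have q0 : 0 < (m + l)%:R ^+ l :> R by rewrite exprn_gt0.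
have -> : ((m + l)%:R `^ (l%:R * p))^-1 = (((m + l)%:R ^+ l)^-1) `^ p.
  rewrite powRrM powR_mulrn// -[(_ ^+ l)^-1](powR_inv1 (ltW q0)) powRAC.
  by rewrite powR_inv1 ?powR_ge0.
apply: ge0_ler_powR; rewrite ?nnegrE ?(ltW p0) ?invr_ge0 ?(ltW q0) ?divr_ge0//.
rewrite ler_pdivlMr ?ltr0n ?fact_gt0// mulrC ler_pdivrMr//.
by rewrite -natrX -natrM ler_nat fact_le_expn.
Qed.

(** As [p (s - 1) = - 1], Bernoulli bounds the ratio of consecutive terms below by
    [(m + 1) / (m + 2)], that of the harmonic series. *)
Lemma sum_rbin_unbounded B : exists n, B < \sum_(m < n) rbin s m `^ p.
Proof.
have low m : s `^ p / m.+1%:R <= rbin s m.+1 `^ p.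
  elim: m => [|m IHm]; first by rewrite rbinS rbin0 mul1r addr0 divr1 divr1.
  have M0 : 0 < m.+1%:R :> R by [].
  have M20 : 0 < m.+2%:R :> R by [].
  have q0 : 0 <= (s + m.+1%:R) / m.+2%:R by rewrite divr_ge0// ltW// ltr_wpDr.
  rewrite rbinS (powRM _ (rbin_ge0 _ s0) q0).
  have h := ler_bernoulli_powR q0 p1.
  apply: (@le_trans _ _ (s `^ p / m.+1%:R * (m.+1%:R / m.+2%:R))).
    by rewrite le_eqVlt; apply/orP; left; apply/eqP; field; rewrite !gt_eqF.
  apply: ler_pM IHm _; rewrite ?divr_ge0 ?powR_ge0//.
  apply: le_trans h; rewrite le_eqVlt; apply/orP; left; apply/eqP.
  rewrite -(natr1 m.+1) /s; field.
  by rewrite nat1r natr1 !gt_eqF.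
have sp0 : 0 < s `^ p by rewrite powR_gt0.
have [n hn] := harmonic_unbounded (B / s `^ p).
exists n.+1; rewrite big_ord_recl /=.
move: hn; rewrite ltr_pdivrMr// => /lt_le_trans; apply.
rewrite mulr_suml; apply: ler_wpDl; first exact: powR_ge0.
by apply: ler_sum => i _; rewrite mulrC; exact: low.
Qed.

Lemma hardy_optimizer_energy_unbounded l B : (0 < l)%N ->
  exists n, B < \sum_(m < n) hardy_weight p l m * rbin (s + l%:R) m `^ p.
Proof.
move=> l0; have [n hn] := sum_rbin_unbounded (B + \sum_(m < l) rbin s m `^ p).
exists n.
apply: (@lt_le_trans _ _ (\sum_(m < n) rbin s (m + l)%N `^ p)); last first.
  by apply: ler_sum => m _; exact: hardy_weight_optimizer_ge.
have : \sum_(m < n) rbin s m `^ p <= \sum_(m < l + n) rbin s m `^ p.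
  by rewrite addnC big_split_ord /= lerDl sumr_ge0// => i _; exact: powR_ge0.
rewrite big_split_ord /= => h.
under eq_bigr do rewrite addnC.
by move: h hn; lra.
Qed.

Lemma test_termE0 del m : test_term p del 0 m = rbin (s - del) m `^ p.
Proof. by rewrite /test_term hardy_weight0// mul1r addr0. Qed.

Let sum_bound del J e :
  (forall n, \sum_(m < n) rbin (s - del) (J + m)%N `^ p <= e) ->
  forall n, \sum_(m < n) rbin (s - del) m `^ p <=
    \sum_(m < J) rbin (s - del) m `^ p + e.
Proof.
move=> h n; apply: (@le_trans _ _ (\sum_(m < J + n) rbin (s - del) m `^ p)).
  by rewrite addnC big_split_ord /= lerDl sumr_ge0// => i _; exact: powR_ge0.
by rewrite big_split_ord /= lerD2l; exact: h.
Qed.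

Let sum_le2 del n : 0 < del -> p * del <= s ->
  \sum_(m < n) rbin (s - del) m `^ p <= 2 / (p * del).
Proof.
move=> d0 d1; rewrite ler_pdivlMr ?mulr_gt0// mulrC.
exact: sum_rbin_powR_le.
Qed.

Let del_lt del : 0 < del -> p * del <= s -> 0 < s - del.
Proof.
by move=> d0 d1; rewrite subr_gt0 (lt_le_trans _ d1)// ltr_pMl.
Qed.

Lemma le_of_scaled_le (x y c : R) : 0 <= c ->
  (forall eta, 0 < eta -> eta <= 1 -> (1 - c * eta) * x <= y + eta) -> x <= y.
Proof.
move=> c0 H; apply/ler_addgt0Pr => e e0.
set d := 1 + c * `|x|; have d0 : 0 < d by rewrite ltr_pwDl// mulr_ge0.
set eta := Num.min 1 (e / d).
have eta0 : 0 < eta by rewrite lt_min ltr01 divr_gt0.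
have eta1 : eta <= 1 by rewrite ge_min lexx.
have etae : eta * d <= e by rewrite -ler_pdivlMr// ge_min lexx orbT.
have := H _ eta0 eta1; have := ler_norm x.
have h : c * eta * x <= c * eta * `|x|.
  by apply: ler_wpM2l; [rewrite mulr_ge0// ltW|exact: ler_norm].
by move: etae h; rewrite /d; lra.
Qed.

Lemma ler_1BM_expn k (q : R) : 0 <= q -> q <= 1 -> 1 - k%:R * q <= (1 - q) ^+ k.
Proof.
move=> q0 q1; elim: k => [|k IHk]; first by rewrite mul0r subr0.
rewrite exprS; apply: le_trans (ler_wpM2l _ IHk); last by rewrite subr_ge0.
have := mulr_ge0 (mulr_ge0 (ler0n R k) q0) q0.
by rewrite -natr1; lra.
Qed.

(* A weight whose Hardy inequality holds for finitely supported sequences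
   satisfies it for the test sequences too. *)
Lemma weighted_test_sum_le del l w B n : 0 < del -> p * del <= s ->
  (forall m, 0 <= w m) ->
  (forall v E, (exists N, forall m, (N <= m)%N -> v m = 0) ->
    (forall k, \sum_(m < k) `|iter l nab v m| `^ p <= E) ->
    forall k, \sum_(m < k) w m * `|v m| `^ p <= E) ->
  (forall k, \sum_(m < k) rbin (s - del) m `^ p <= B) ->
  \sum_(m < n) w m * rbin (s - del + l%:R) m `^ p <= B.
Proof.
move=> d0 d1 w0 H hB; have a0 := del_lt d0 d1.
apply: (le_of_scaled_le (ltW p0)) => eta eta0 eta1.
have [v [vfin _ vlow [J vJ]]] :=
  finite_support_approx p1 l 0 n a0 eta0 hB.
have zE : truncated_test (s - del) l 0 = rbin (s - del + l%:R).
  by apply/funext.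
have bound k : \sum_(m < k) `|iter l nab v m| `^ p <= B + eta.
  apply: le_trans (vJ k) _; rewrite lerD2r zE iter_nab_rbin.
  under eq_bigr do rewrite ger0_norm ?rbin_ge0//.
  exact: hB.
apply: le_trans (H v _ vfin bound n).
rewrite mulr_sumr; apply: ler_sum => m _.
rewrite mulrCA; apply: ler_wpM2l => //.
have r0 : 0 <= rbin (s - del + l%:R) m by rewrite rbin_ge0// ltr_wpDr.
apply: le_trans (ler_1BM_powR p1 (ltW eta0) eta1 r0) _.
have lo : 0 <= (1 - eta) * rbin (s - del + l%:R) m.
  by rewrite mulr_ge0// subr_ge0.
apply: ge0_ler_powR; rewrite ?nnegrE ?(ltW p0)//.
apply: le_trans (ler_norm _); have := vlow m (ltn_ord m).
by rewrite zE.
Qed.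

(** A gap [g] at one index adds at least [g] to the weighted sum of a test sequence, so it is
    bounded by the total deficit, which is [O(del)]. *)
Lemma hardy_weight_critical l w : (0 < l)%N ->
  (forall m, 0 <= w m) ->
  (forall v E, (exists N, forall m, (N <= m)%N -> v m = 0) ->
    (forall k, \sum_(m < k) `|iter l nab v m| `^ p <= E) ->
    forall k, \sum_(m < k) w m * `|v m| `^ p <= E) ->
  (forall m, hardy_weight p l m <= w m) ->
  forall m, w m = hardy_weight p l m.
Proof.
move=> l0 w0 H hw m1; apply/eqP; rewrite eq_le hw andbT -subr_le0.
set g := w m1 - _; have g0 : 0 <= g by rewrite subr_ge0.
(* The first term is [l (p del / s) ^ 2] times the energy bound [2 / (p del)], divided by [del]; the
   final 2 pays for the two errors [del] in [tail] and [rev]. *)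
pose C : R := l%:R * p / s ^+ 2 * 2 + 2.
have C0 : 0 < C.
  rewrite ltr_wpDl// mulr_ge0// divr_ge0 ?sqr_ge0//.
  exact: mulr_ge0 (ler0n _ _) (ltW p0).
have key del : 0 < del -> p * del <= s -> g <= C * del.
  move=> d0 d1; have a0 := del_lt d0 d1.
  have [J _ tail] := nonneg_series_tail 0 d0
    (fun m => powR_ge0 (rbin (s - del) m) p) (fun n => sum_le2 n d0 d1).
  have [n' Jn' rev] := test_term_reverse p1 d0 d1 l J d0.
  set A := \sum_(m < J) rbin (s - del) m `^ p in tail.
  set q := (p * del / s) ^+ 2 in rev.
  have hA : \sum_(m < J) test_term p del 0 m = A.
    by apply: eq_bigr => m _; rewrite test_termE0.
  rewrite -/s -/q hA in rev.
  have hB := sum_bound tail.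
  have := weighted_test_sum_le (maxn n' m1.+1) d0 d1 w0 H hB; rewrite -/A => up.
  (* Because [l >= 1], the test sequence dominates [rbin 1 = 1], and the gap is not diminished. *)
  have r1 : 1 <= rbin (s - del + l%:R) m1.
    rewrite -[X in X <= _](rbin1 R m1); apply: ler_rbin => //.
    by apply: (@le_trans _ _ l%:R); [rewrite ler1n|rewrite lerDr ltW].
  have lo : \sum_(m < n') test_term p del l m + g <=
      \sum_(m < maxn n' m1.+1) w m * rbin (s - del + l%:R) m `^ p.
    have m1n : (m1 < maxn n' m1.+1)%N by exact: leq_maxr.
    apply: (@le_trans _ _ (\sum_(m < maxn n' m1.+1) test_term p del l m + g)).
      rewrite lerD2r -(subnKC (leq_maxl n' m1.+1)) big_split_ord /= lerDl.
      by apply: sumr_ge0 => i _; exact: test_term_ge0.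
    rewrite [in leLHS](bigD1 (Ordinal m1n))//=.
    rewrite [in leRHS](bigD1 (Ordinal m1n))//= addrAC.
    apply: lerD; last first.
      by apply: ler_sum => i _; apply: ler_wpM2r; rewrite ?powR_ge0.
    rewrite /test_term -/s -lerBrDl -mulrBl ler_peMr//.
    have : 1 `^ p <= rbin (s - del + l%:R) m1 `^ p.
      by apply: ge0_ler_powR; rewrite ?nnegrE ?(ltW p0)// (le_trans _ r1).
    by rewrite powR1.
  have q0 : 0 <= q by exact: sqr_ge0.
  have e0 : 0 <= p * del / s := divr_ge0 (mulr_ge0 (ltW p0) (ltW d0)) (ltW s0).
  have q1 : q <= 1 by apply: exprn_ile1 => //; rewrite ler_pdivrMr// mul1r.
  have bern := ler_1BM_expn l q0 q1.
  have A0 : 0 <= A by apply: sumr_ge0 => i _; exact: powR_ge0.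
  have hA2 : A <= 2 / (p * del) by exact: sum_le2.
  have h1 : (1 - l%:R * q) * A <= (1 - q) ^+ l * A by apply: ler_wpM2r.
  have h2 : l%:R * q * A <= l%:R * p / s ^+ 2 * 2 * del.
    apply: le_trans (ler_wpM2l _ hA2) _; first exact: mulr_ge0.
    rewrite le_eqVlt; apply/orP; left; apply/eqP; rewrite /q.
    by field; rewrite !gt_eqF.
  by move: rev up lo h1 h2; rewrite /C; lra.
rewrite leNgt; apply/negP => gpos.
pose del := Num.min (s / p) (g / (2 * C)).
have d0 : 0 < del by rewrite lt_min !divr_gt0// mulr_gt0.
have d1 : p * del <= s by rewrite mulrC -ler_pdivlMr// ge_min lexx.
have := key _ d0 d1.
have : C * del <= g / 2.
  rewrite mulrC -ler_pdivlMr//; apply: le_trans (_ : g / (2 * C) <= _).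
    by rewrite ge_min lexx orbT.
  by rewrite invfM mulrA.
by move: gpos; lra.
Qed.

(** Scaling [s] by [1 - t / p] costs at most the factor [(1 - t / p) ^ m] in the term of rank [m],
    hence [(1 - t) ^ m >= 1 - n t] after the [p]-th power. *)
Let sum_perturbed_ge (t : R) n : 0 <= t -> t < 1 -> n%:R * t <= 2^-1 ->
  2^-1 * \sum_(m < n) rbin s m `^ p <=
  \sum_(m < n) rbin (s - t * s / p) m `^ p.
Proof.
move=> t0 t1 nt; rewrite mulr_sumr; apply: ler_sum => m _.
pose e := t / p.
have e0 : 0 <= e by rewrite divr_ge0// ltW.
have te : p * e = t by rewrite /e mulrC divfK// gt_eqF.
have et : e <= t by rewrite -te ler_peMl// ltW.
have e1 : 0 < 1 - e by rewrite subr_gt0 (le_lt_trans et).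
have low k : (1 - e) ^+ k * rbin s k <= rbin (s - t * s / p) k.
  have sE : s - t * s / p = (1 - e) * s by rewrite /e; ring.
  elim: k => [|k IHk]; first by rewrite !rbin0 mulr1.
  rewrite !rbinS exprSr mulrACA; apply: ler_pM.
  - by rewrite mulr_ge0 ?rbin_ge0// exprn_ge0// ltW.
  - by rewrite mulr_ge0 ?(ltW e1)// divr_ge0// ltW// ltr_wpDr.
  - exact: IHk.
  rewrite mulrA ler_pM2r ?invr_gt0// sE mulrDr lerD2l ler_piMl//.
  by rewrite gerBl.
have l0 : 0 <= (1 - e) ^+ m * rbin s m.
  by rewrite mulr_ge0 ?rbin_ge0// exprn_ge0// ltW.
apply: le_trans (_ : ((1 - e) ^+ m * rbin s m) `^ p <= _); last first.
  by apply: ge0_ler_powR; rewrite ?nnegrE ?(ltW p0)// (le_trans l0).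
rewrite (powRM _ (exprn_ge0 m (ltW e1)) (rbin_ge0 m s0)).
apply: ler_wpM2r; first exact: powR_ge0.
rewrite -powR_mulrn ?(ltW e1)// powRAC powR_mulrn ?powR_ge0//.
have h := ler_bernoulli_powR (ltW e1) p1.
have h1 : 1 - t <= (1 - e) `^ p.
  by apply: le_trans h; rewrite -te le_eqVlt; apply/orP; left; apply/eqP; ring.
apply: le_trans (_ : (1 - t) ^+ m <= _); last first.
  by apply: lerXn2r; rewrite ?nnegrE ?powR_ge0// subr_ge0 ltW.
apply: le_trans (ler_1BM_expn m t0 (ltW t1)).
have : m%:R * t <= n%:R * t by rewrite ler_wpM2r// ler_nat ltnW.
by move: nt; lra.
Qed.

Lemma hardy_weight_near_infinity l m0 eps : (0 < l)%N -> 0 < eps ->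
  exists v : nat -> R,
    [/\ exists N, forall m, (N <= m)%N -> v m = 0,
        forall m, (m < m0)%N -> v m = 0
      & exists B n, (forall k, \sum_(m < k) `|iter l nab v m| `^ p <= B) /\
          B < (1 + eps) * \sum_(m < n) hardy_weight p l m * `|v m| `^ p].
Proof.
move=> l0 eps0.
(* [C3] bounds the energy created by truncating at [m0], and [C4] the weighted norm lost; comparison
   with [rbin (1 + l)] makes both independent of [del]. *)
set Z : R := \sum_(i < m0 + l) rbin (1 + l%:R) i.
set C3 : R := \sum_(m < m0 + l) (2 ^+ l * Z) `^ p.
set C4 : R := \sum_(m < m0) hardy_weight p l m * rbin (1 + l%:R) m `^ p.
have rl0 m : 0 <= rbin (1 + l%:R) m :> R by rewrite rbin_ge0// ltr_wpDr.
have C30 : 0 <= C3 by apply: sumr_ge0 => i _; exact: powR_ge0.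
have C40 : 0 <= C4.
  apply: sumr_ge0 => i _.
  by rewrite mulr_ge0 ?powR_ge0// ltW// hardy_weight_gt0.
(* Two losses of the factor [1 - ka] still leave [(1 + eps) (1 - 2 ka) = 1 + eps / 2]. *)
pose ka := eps / (4 * (1 + eps)).
have e10 : 0 < 1 + eps by rewrite addr_gt0.
have ka0 : 0 < ka by rewrite divr_gt0// mulr_gt0.
have kaE : ka * (1 + eps) = eps / 4 by rewrite /ka; field; rewrite gt_eqF.
have ka1 : ka <= 1.
  by rewrite ler_pdivrMr ?mulr_gt0// mul1r; move: eps0; lra.
(* Once [2 A > L], the surplus [(eps / 2) A] outweighs all bounded errors. *)
pose L := 2 * (2 / eps * (C3 + 2 + (1 + eps) * (1 + C4))).
have [n0 hn0] := sum_rbin_unbounded L.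
(* Here [t = p del / s]: the first bound controls the loss [(1 - t ^ 2) ^ l], the second allows
   [sum_perturbed_ge] at [n0]. *)
pose t := Num.min (ka / l%:R) (n0.+1%:R^-1 / 2).
have lR0 : 0 < l%:R :> R by rewrite ltr0n.
have t0 : 0 < t by rewrite lt_min (divr_gt0 ka0 lR0) divr_gt0 ?invr_gt0.
have tl : l%:R * t <= ka by rewrite mulrC -ler_pdivlMr// ge_min lexx.
have tn : n0.+1%:R * t <= 2^-1.
  rewrite mulrC -ler_pdivlMr// ge_min; apply/orP; right.
  by rewrite mulrC.
have t1 : t < 1.
  apply: le_lt_trans (_ : 2^-1 < 1); last by rewrite invf_lt1// ltr1n.
  by apply: le_trans tn; rewrite ler_peMl ?ler1n// ltW.
pose del := t * s / p.
have d0 : 0 < del by rewrite divr_gt0// mulr_gt0.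
have pd : p * del = t * s by rewrite /del mulrC divfK// gt_eqF.
have d1 : p * del <= s by rewrite pd ler_piMl// ltW.
have a0 := del_lt d0 d1.
have a1 : s - del <= 1 by rewrite lerBlDr (le_trans (ltW s1))// lerDl ltW.
have al m : rbin (s - del + l%:R) m <= rbin (1 + l%:R) m.
  by apply: ler_rbin; [rewrite ltr_wpDr|rewrite lerD2r].
have [J nJ tail] := nonneg_series_tail n0 (@ltr01 R)
  (fun m => powR_ge0 (rbin (s - del) m) p) (fun n => sum_le2 n d0 d1).
have [n' _ rev] := test_term_reverse p1 d0 d1 l J (@ltr01 R).
set A := \sum_(m < J) rbin (s - del) m `^ p in tail.
have hA : \sum_(m < J) test_term p del 0 m = A.
  by apply: eq_bigr => m _; rewrite test_termE0.
have qE : p * del / s = t by rewrite pd mulfK// gt_eqF.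
rewrite -/s hA qE in rev.
have hB := sum_bound tail; rewrite -/A in hB.
have AL : L < 2 * A.
  apply: lt_le_trans hn0 _; rewrite mulrC -ler_pdivrMr//.
  have tn0 : n0%:R * t <= 2^-1.
    by apply: le_trans tn; rewrite ler_wpM2r ?(ltW t0)// ler_nat.
  rewrite mulrC; apply: le_trans (sum_perturbed_ge (ltW t0) t1 tn0) _.
  rewrite /A -(subnKC nJ) big_split_ord /= lerDl.
  by apply: sumr_ge0 => i _; exact: powR_ge0.
pose z := truncated_test (s - del) l m0.
pose eta := ka / p.
have eta0 : 0 < eta by rewrite divr_gt0.
have eta1 : eta <= 1.
  by rewrite ler_pdivrMr// mul1r (le_trans ka1)// ltW.
have [v [vfin v0 vlow [J' vJ]]] :=
  finite_support_approx p1 l m0 n' a0 eta0 hB.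
exists v; split => //; exists (C3 + A + 2), n'; split.
  move=> k; apply: le_trans (vJ k) _.
  have split1 : \sum_(m < J') `|iter l nab z m| `^ p <=
      C3 + (A + 1).
    apply: (@le_trans _ _ (\sum_(m < m0 + l + J') `|iter l nab z m| `^ p)).
      rewrite addnC big_split_ord /= lerDl.
      by apply: sumr_ge0 => i _; exact: powR_ge0.
    rewrite big_split_ord /=; apply: lerD.
      apply: ler_sum => i _; apply: ge0_ler_powR; rewrite ?nnegrE ?(ltW p0)//.
        by rewrite mulr_ge0 ?exprn_ge0// sumr_ge0.
      apply: iter_nab_le => j ji; rewrite ger0_norm ?truncated_test_ge0//.
      have jml : (j < m0 + l)%N by exact: leq_ltn_trans ji _.
      apply: (@le_trans _ _ (rbin (1 + l%:R) j)).
        by rewrite /z /truncated_test; case: ifP.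
      by rewrite /Z (bigD1 (Ordinal jml))//= lerDl sumr_ge0.
    apply: le_trans (hB (m0 + l + J')%N).
    rewrite [in leRHS]big_split_ord /=; apply: ler_wpDl.
      by apply: sumr_ge0 => i _; exact: powR_ge0.
    apply: ler_sum => i _.
    rewrite (@eq_iter_nab_tail _ l z
      (rbin (s - del + l%:R)) _ m0) ?leq_addr//; last first.
      by move=> j m0j; rewrite /z /truncated_test ltnNge m0j.
    by rewrite iter_nab_rbin ger0_norm// rbin_ge0.
  by move: split1 eta1; lra.
have low : (1 - ka) * (\sum_(m < n') test_term p del l m - C4) <=
    \sum_(m < n') hardy_weight p l m * `|v m| `^ p.
  apply: (@le_trans _ _ ((1 - ka) * \sum_(m < n')
      hardy_weight p l m * z m `^ p)).
    apply: ler_wpM2l; first by rewrite subr_ge0.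
    rewrite lerBlDr; apply: (@le_trans _ _ (\sum_(m < n')
      (hardy_weight p l m * z m `^ p +
       (if (m < m0)%N then hardy_weight p l m * rbin (1 + l%:R) m `^ p
        else 0)))).
      apply: ler_sum => m _; rewrite /test_term /z /truncated_test -/s.
      have w0 : 0 <= hardy_weight p l m by rewrite ltW// hardy_weight_gt0.
      case: ifP => _; last by rewrite addr0.
      rewrite powR0 ?gt_eqF// mulr0 add0r; apply: ler_wpM2l => //.
      apply: ge0_ler_powR; rewrite ?nnegrE ?(ltW p0) ?rl0 ?al//.
      by rewrite rbin_ge0// ltr_wpDr.
    rewrite big_split /= lerD2l.
    set F := fun m => if (m < m0)%N then
      hardy_weight p l m * rbin (1 + l%:R) m `^ p else 0.
    have F0 m : 0 <= F m.
      rewrite /F; case: ifP => // _.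
      by rewrite mulr_ge0 ?powR_ge0// ltW// hardy_weight_gt0.
    apply: (@le_trans _ _ (\sum_(m < m0 + n') F m)).
      by rewrite addnC big_split_ord /= lerDl sumr_ge0.
    rewrite big_split_ord /= [X in _ + X]big1 ?addr0.
      by apply: ler_sum => i _; rewrite /F ltn_ord.
    by move=> i _; rewrite /F ltnNge leq_addr.
  rewrite mulr_sumr; apply: ler_sum => m _.
  rewrite mulrCA; apply: ler_wpM2l; first by rewrite ltW// hardy_weight_gt0.
  have z0 := truncated_test_ge0 l m0 m a0.
  have -> : ka = p * eta by rewrite /eta mulrC divfK// gt_eqF.
  apply: le_trans (ler_1BM_powR p1 (ltW eta0) eta1 z0) _.
  have lo : 0 <= (1 - eta) * z m by rewrite mulr_ge0// subr_ge0.
  apply: ge0_ler_powR; rewrite ?nnegrE ?(ltW p0)//.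
  exact: le_trans (vlow m (ltn_ord m)) (ler_norm _).
have t20 : 0 <= t ^+ 2 by exact: sqr_ge0.
have t21 : t ^+ 2 <= 1 by apply: exprn_ile1 => //; exact: ltW.
have bern := ler_1BM_expn l t20 t21.
have lt2 : l%:R * t ^+ 2 <= ka.
  apply: le_trans tl; rewrite ler_pM2l// expr2 ler_piMl// ltW//.
have A0 : 0 <= A by apply: sumr_ge0 => i _; exact: powR_ge0.
have h1 : (1 - ka) * A <= (1 - t ^+ 2) ^+ l * A.
  by apply: ler_wpM2r => //; apply: le_trans bern; rewrite lerD2l lerN2.
have h2 : (1 - ka) * ((1 - ka) * A - 1 - C4) <=
    \sum_(m < n') hardy_weight p l m * `|v m| `^ p.
  apply: le_trans low; apply: ler_wpM2l; first by rewrite subr_ge0.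
  by move: h1 rev; lra.
have h3 : (1 - 2 * ka) * A - 1 - C4 <= (1 - ka) * ((1 - ka) * A - 1 - C4).
  have : 0 <= ka * ka * A by rewrite mulr_ge0// mulr_ge0 ?(ltW ka0).
  have : 0 <= ka * C4 by rewrite mulr_ge0 ?(ltW ka0).
  by move: ka0; lra.
apply: lt_le_trans (ler_wpM2l (ltW e10) (le_trans h3 h2)).
have -> : (1 + eps) * ((1 - 2 * ka) * A - 1 - C4) =
    (1 + eps) * A - 2 * (ka * (1 + eps)) * A - (1 + eps) * (1 + C4) by ring.
rewrite kaE.
move: AL; rewrite /L ltr_pM2l// mulrAC ltr_pdivrMr// => h.
by move: h; lra.
Qed.

End HardyWeightOptimality.

(** * Back to sequences indexed by the integers *)

Section SeriesFromRank.
Variable R : realType.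
Implicit Types (f : nat -> R) (l k : nat) (x : \bar R).

Let sum_from_rank f l k :
  (\sum_(l <= i < l + k) (f i)%:E)%E = (\sum_(m < k) f (l + m)%N)%:E.
Proof.
rewrite -{1}(add0n l) big_addn addKn big_mkord -sumEFin.
by apply: eq_bigr => i _; rewrite addnC.
Qed.

Lemma nneseries_ge_partial f l k : (forall i, (l <= i)%N -> 0 <= f i) ->
  ((\sum_(m < k) f (l + m)%N)%:E <= \sum_(l <= i <oo) (f i)%:E)%E.
Proof.
move=> f0; rewrite -sum_from_rank; apply: nneseries_lim_ge => i li _.
by rewrite lee_fin f0.
Qed.

Lemma nneseries_le_partial f l x : (forall i, (l <= i)%N -> 0 <= f i) ->
  (forall k, ((\sum_(m < k) f (l + m)%N)%:E <= x)%E) ->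
  (\sum_(l <= i <oo) (f i)%:E <= x)%E.
Proof.
move=> f0 H; apply: lime_le.
  by apply: is_cvg_nneseries => i li _; rewrite lee_fin f0.
near=> k; have lk : (l <= k)%N by near: k; exact: nbhs_infty_ge.
by rewrite -(subnKC lk) sum_from_rank.
Unshelve. all: by end_near. Qed.

End SeriesFromRank.

Section Reindexing.
Variable R : realType.
Implicit Types (u : int -> R[i]) (A G : nat -> R) (j k l m : nat).

(** The vanishing below [l] is carried through the induction because it justifies the convention of
    [nab] at 0. *)
Lemma iter_nabla_shift l k u : Hspace l u ->
  (forall m, iter k (@nabla R) u (l + m)%:Z =
             iter k nab (fun m => u (l + m)%:Z) m) /\
  Hspace l (iter k (@nabla R) u).
Proof.
move=> ul; elim: k => [|k [IH1 IH2]]; first by split.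
split => [m|n nl] /=; last first.
  rewrite /nabla !IH2 ?subr0//.
  by rewrite (lt_trans _ nl)// ltrBlDr ltrDl.
rewrite /nabla; case: m => [|m] /=.
  rewrite addn0 -(IH1 0%N) addn0 (IH2 (l%:Z - 1)) ?subr0//.
  by rewrite ltrBlDr ltrDl.
have -> : (l + m.+1)%:Z - 1 = (l + m)%:Z by rewrite addnS -addn1 PoszD addrK.
by rewrite (IH1 m.+1) (IH1 m).
Qed.

(** Each [dvg] is minus a [dif]; being a forward difference, it involves no index below [l]. *)
Lemma iter_dvg_shift l k (F : int -> R[i]) G :
  (forall m, F (l + m)%:Z = (G m)%:C) ->
  forall m, iter k (@dvg R) F (l + m)%:Z = ((-1) ^+ k * iter k dif G m)%:C.
Proof.
move=> FG; elim: k => [|k IHk] m; first by rewrite expr0 mul1r; exact: FG.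
rewrite /= /dvg.
have -> : (l + m)%:Z + 1 = (l + m.+1)%:Z by rewrite addnS -addn1 PoszD.
rewrite !IHk -rmorphB; congr (_%:C).
by rewrite exprS /dif; ring.
Qed.

Lemma iter_difZ k (c : R) A m :
  iter k dif (fun m => c * A m) m = c * iter k dif A m.
Proof.
elim: k A => [|k IHk] A //; rewrite !iterSr -IHk; congr (iter k dif _ m).
by apply/funext => i; rewrite /dif mulrBr.
Qed.

Lemma iter_dif_binomial k A m :
  iter k dif A m = \sum_(0 <= j < k.+1) (-1) ^+ j * 'C(k, j)%:R * A (m + j)%N.
Proof.
elim: k m => [|k IHk] m.
  by rewrite big_nat1 bin0 expr0 !mul1r addn0.
rewrite iterS /dif !IHk !big_mkord.
pose T j : R := (-1) ^+ j * 'C(k, j)%:R * A (m + j)%N.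
have e1 : \sum_(j < k.+1) T j = A m + \sum_(j < k.+1) T j.+1.
  have <- : T 0%N = A m by rewrite /T bin0 expr0 !mul1r addn0.
  rewrite -(big_ord_recl _ (fun j : 'I_k.+2 => T j)) [in RHS]big_ord_recr /=.
  have -> : T k.+1 = 0 by rewrite /T bin_small// mulr0 mul0r.
  by rewrite addr0.
rewrite [X in X - _]e1 [in RHS]big_ord_recl /= bin0 expr0 !mul1r addn0.
rewrite -addrA; congr (_ + _); rewrite -sumrB; apply: eq_bigr => j _.
rewrite /T /bump /= add1n binS natrD addnS addSn exprS; ring.
Qed.

End Reindexing.

(** * Gamma quotients as rising binomials *)

Section GammaRatios.
Variable R : realType.
Implicit Types (x : R) (k l m n : nat).

Lemma GammaD x k : 0 < x -> Gamma (x + k%:R) = pochhammer x k * Gamma x.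
Proof.
move=> x0; elim: k => [|k IHk].
  by rewrite addr0 /pochhammer big_ord0 mul1r.
have xk0 : 0 < x + k%:R by rewrite ltr_wpDr.
have xk10 : 0 < x + k%:R + 1 by rewrite addr_gt0.
rewrite -natr1 addrA (Gamma_pos xk10) Gamma_integralS// -(Gamma_pos xk0) IHk.
by rewrite pochhammerS; ring.
Qed.

Lemma Gamma_gt0 x : 0 < x -> 0 < Gamma x.
Proof. by move=> x0; rewrite Gamma_pos// Gamma_integral_gt0. Qed.

Lemma pochhammer_one m : pochhammer (1 : R) m = m`!%:R.
Proof.
elim: m => [|m IHm]; first by rewrite /pochhammer big_ord0.
by rewrite pochhammerS IHm nat1r -natrM mulnC -factS.
Qed.

Variables (p q : R).
Hypothesis p1 : 1 < p.
Hypothesis pq : p^-1 + q^-1 = 1.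

Let s := 1 - p^-1.
Let sq : q^-1 = s. Proof. by rewrite /s -pq addrC addKr. Qed.
Let s0 : 0 < s. Proof. by rewrite subr_gt0 invf_lt1// (lt_trans _ p1). Qed.

(** [Gamma 1] is left unevaluated, since [c] cancels in the weight. *)
Let c : R := Gamma s / Gamma 1.
Let c0 : 0 < c. Proof. by rewrite divr_gt0// Gamma_gt0. Qed.

Lemma gseq_nat l m : gseq l q (l + m)%:Z =
  c * pochhammer s l * rbin (s + l%:R) m.
Proof.
rewrite /gseq rGammaE sq -pmulrn.
have -> : (l + m)%:R + s = s + (l + m)%:R :> R by rewrite addrC.
have -> : (l + m)%:R - l%:R + 1 = 1 + m%:R :> R.
  by rewrite natrD; ring.
rewrite !GammaD// pochhammer_one pochhammerD /rbin /c.
have f0 : (m`!%:R : R) != 0 by rewrite pnatr_eq0 -lt0n fact_gt0.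
by field; rewrite f0 gt_eqF ?Gamma_gt0.
Qed.

(** Below [l] the argument [n - l + 1] is a pole of Gamma. *)
Lemma gseq_lt_rank l (n : int) : n < l%:Z -> gseq l q n = 0.
Proof.
move=> nl; have [k kE] : exists k : nat, l%:Z - 1 - n = k%:Z.
  exists (absz (l%:Z - 1 - n)%R); rewrite gez0_abs//.
  by rewrite subr_ge0 lerBrDr lezD1.
have -> : gseq l q n = Gamma (n%:~R + q^-1) * rGamma (- k%:R).
  rewrite /gseq; congr (_ * rGamma _); rewrite -[k%:R]/((k%:Z)%:~R) -kE.
  by rewrite !rmorphB /=; ring.
by rewrite rGamma_nonpos mulr0.
Qed.

Lemma rho_explicitE l m : rho_explicit l p q (l + m) = hardy_weight p l m.
Proof.
rewrite /rho_explicit sq.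
have -> : (l + m)%:R - l%:R + 1 = 1 + m%:R :> R.
  by rewrite natrD; ring.
have -> : (l + m)%:R + s = s + (l + m)%:R :> R by rewrite addrC.
have f0 k : (k`!%:R : R) != 0 by rewrite pnatr_eq0 -lt0n fact_gt0.
have G0 := Gamma_gt0 s0; have G10 := Gamma_gt0 (@ltr01 R).
have E j : (Gamma ((l + m)%:R - l%:R + j%:R + s) /
    Gamma ((l + m)%:R - l%:R + j%:R + 1)) `^ (p - 1) =
    c `^ (p - 1) * hardy_base p (m + j).
  have -> : (l + m)%:R - l%:R + j%:R + s = s + (m + j)%:R :> R.
    by rewrite !natrD; ring.
  have -> : (l + m)%:R - l%:R + j%:R + 1 = 1 + (m + j)%:R :> R.
    by rewrite !natrD; ring.
  rewrite !GammaD// pochhammer_one /hardy_base.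
  rewrite -(powRM _ (ltW c0) (rbin_ge0 _ s0)).
  by congr (_ `^ _); rewrite /c /rbin; field; rewrite f0 gt_eqF.
under eq_big_nat do rewrite E.
rewrite !GammaD// pochhammer_one.
have -> : \sum_(0 <= j < l.+1) (-1) ^+ j * 'C(l, j)%:R *
    (c `^ (p - 1) * hardy_base p (m + j)) =
    c `^ (p - 1) * iter l dif (hardy_base p) m.
  rewrite iter_dif_binomial mulr_sumr; apply: eq_bigr => j _; ring.
have P0 := pochhammer_gt0 l s0.
have sl0 : 0 < s + l%:R by rewrite ltr_wpDr.
have R0 := rbin_gt0 m sl0.
have PR0 : 0 < pochhammer s l * rbin (s + l%:R) m by exact: mulr_gt0.
have -> : m`!%:R * Gamma 1 / (pochhammer s (l + m) * Gamma s) =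
    (c * (pochhammer s l * rbin (s + l%:R) m))^-1.
  rewrite pochhammerD /rbin /c; field.
  by rewrite f0 !gt_eqF ?pochhammer_gt0.
have cP0 := mulr_gt0 c0 PR0.
rewrite -[(c * _)^-1](powR_inv1 (ltW cP0)) powRAC powR_inv1 ?powR_ge0//.
rewrite (powRM _ (ltW c0) (ltW PR0)) (powRM _ (ltW P0) (ltW R0)).
rewrite /hardy_weight -/s.
by field; rewrite !gt_eqF ?powR_gt0.
Qed.

End GammaRatios.

(** * The defining properties of an optimal weight *)

Section OptimalWeight.
Variables (R : realType) (p : R).
Hypothesis p1 : 1 < p.
Variable l : nat.
Hypothesis l0 : (0 < l)%N.
Implicit Types (u : int -> R[i]) (rho : nat -> R) (k m n : nat).

Let s := 1 - p^-1.
Let p0 : 0 < p. Proof. exact: lt_trans p1. Qed.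
Let s0 : 0 < s. Proof. by rewrite subr_gt0 invf_lt1. Qed.

Definition from_rank (v : nat -> R[i]) : int -> R[i] := fun n : int =>
  if n is Posz k then if (l <= k)%N then v (k - l)%N else 0 else 0.

Lemma from_rank_nat v m : from_rank v (l + m)%:Z = v m.
Proof. by rewrite /from_rank leq_addr addKn. Qed.

Lemma from_rank_H0space v m0 : (exists N, forall m, (N <= m)%N -> v m = 0) ->
  (forall m, (m < m0)%N -> v m = 0) -> H0space (l + m0) (from_rank v).
Proof.
move=> [N vN] vm0; split.
  case=> // k; rewrite ltz_nat /from_rank => klm; case: ifP => // lk.
  by apply: vm0; rewrite ltn_subLR.
apply: (@sub_finite_set _ _ (Posz @` `I_(l + N))); last first.
  exact/finite_image/finite_II.
case=> [k|k] /=; last by rewrite eqxx.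
move=> h; exists k => //=; rewrite ltnNge; apply: contra h => lNk.
rewrite /from_rank; case: ifP => // _; apply/eqP/vN.
by rewrite leq_subRL// (leq_trans _ lNk)// leq_addr.
Qed.

Lemma energy_ge_partial u k : Hspace l u ->
  ((\sum_(m < k) cabs (iter l nab (fun m : nat => u (l + m)%:Z) m) `^ p)%:E
   <= energy l p u)%E.
Proof.
move=> ul; have [h _] := iter_nabla_shift l ul.
under eq_bigr do rewrite -h.
apply: (nneseries_ge_partial
  (f := fun n => cabs (iter l (@nabla R) u n%:Z) `^ p)).
by move=> i _; exact: powR_ge0.
Qed.

Lemma energy_le_partial u x : Hspace l u ->
  (forall k,
    ((\sum_(m < k) cabs (iter l nab (fun m : nat => u (l + m)%:Z) m) `^ p)%:E
     <= x)%E) -> (energy l p u <= x)%E.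
Proof.
move=> ul H; have [h _] := iter_nabla_shift l ul.
apply: (nneseries_le_partial
  (f := fun n => cabs (iter l (@nabla R) u n%:Z) `^ p)).
  by move=> i _; exact: powR_ge0.
by move=> k; under eq_bigr do rewrite h; exact: H.
Qed.

Lemma weighted_norm_ge_partial rho u k : (forall n, (l <= n)%N -> 0 <= rho n) ->
  ((\sum_(m < k) rho (l + m)%N * cabs (u (l + m)%:Z) `^ p)%:E
   <= weighted_norm l p rho u)%E.
Proof.
move=> r0.
apply: (nneseries_ge_partial (f := fun n => rho n * cabs (u n%:Z) `^ p)).
by move=> i li; rewrite mulr_ge0 ?powR_ge0 ?r0.
Qed.

Lemma weighted_norm_le_partial rho u x : (forall n, (l <= n)%N -> 0 <= rho n) ->
  (forall k, ((\sum_(m < k) rho (l + m)%N * cabs (u (l + m)%:Z) `^ p)%:E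
   <= x)%E) -> (weighted_norm l p rho u <= x)%E.
Proof.
move=> r0.
apply: (nneseries_le_partial (f := fun n => rho n * cabs (u n%:Z) `^ p)).
by move=> i li; rewrite mulr_ge0 ?powR_ge0 ?r0.
Qed.

Variable rho : nat -> R.
Hypothesis rhoE : forall m, rho (l + m)%N = hardy_weight p l m.

Let rho_ge0 n : (l <= n)%N -> 0 <= rho n.
Proof. by move=> /subnKC <-; rewrite rhoE ltW// hardy_weight_gt0. Qed.

Lemma hardy_HRB_weight : HRB_weight l p rho.
Proof.
split=> // u [ul _]; apply: weighted_norm_le_partial => // k.
apply: le_trans (energy_ge_partial k ul); rewrite lee_fin.
under eq_bigr do rewrite rhoE.
exact: (hardy_chain p1 l (fun m : nat => u (l + m)%:Z)).
Qed.

Lemma hardy_critical : critical l p rho.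
Proof.
move=> rho' [r0 H] hr n ln; rewrite -(subnKC ln) rhoE.
apply: (hardy_weight_critical p1 (w := fun m => rho' (l + m)%N) l0).
- by move=> m; rewrite r0// leq_addr.
- move=> v E [N vN] hE k.
  pose u := from_rank (fun m => (v m)%:C).
  have uE : (fun m : nat => u (l + m)%:Z) = (fun m => (v m)%:C).
    by apply/funext => m; rewrite /u from_rank_nat.
  have uH : H0space l u.
    rewrite -[l in H0space l]addn0; apply: from_rank_H0space => //.
    by exists N => m Nm; rewrite vN.
  rewrite -lee_fin; apply: (@le_trans _ _ (energy l p u)); last first.
    apply: energy_le_partial; first by case: uH.
    move=> i; rewrite uE lee_fin.
    under eq_bigr do rewrite iter_nab_real cabs_real.
    exact: hE.
  apply: le_trans (H _ uH); apply: le_trans (weighted_norm_ge_partial u k r0).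
  rewrite lee_fin le_eqVlt; apply/orP; left; apply/eqP; apply: eq_bigr => m _.
  by rewrite /u from_rank_nat cabs_real.
- by move=> m; rewrite -rhoE hr// leq_addr.
Qed.

(** Equality annihilates every Picone defect of the step of index [l - 1], which makes [u] a
    multiple of the optimizer, whose weighted norm is infinite. *)
Lemma hardy_non_attainable : non_attainable l p rho.
Proof.
move=> u ul wfin eqE; pose U m := u (l + m)%:Z.
have lE : l = l.-1.+1 by rewrite prednK.
have defect k : picone_defect p l.-1 U k = 0.
  set D := iter l.-1 dif (hardy_base p) k * picone_defect p l.-1 U k.
  have d0 := iter_dif_hardy_base_gt0 p1 l.-1 k.
  have pd0 : 0 <= picone_defect p l.-1 U k by exact: picone_defect_ge0.
  have : (weighted_norm l p rho u <= energy l p u - D%:E)%E.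
    apply: weighted_norm_le_partial => // n.
    rewrite leeBrDr//; apply: (@le_trans _ _ (\sum_(m < k.+1 + n)
        cabs (iter l nab U m) `^ p)%:E); last exact: energy_ge_partial.
    rewrite -EFinD lee_fin.
    have kn : (k < k.+1 + n)%N by exact: leq_addr.
    have h1 := hardy_step_defect p1 l.-1 U kn.
    rewrite [in leRHS]lE; under [in leRHS]eq_bigr do rewrite iterSr.
    apply: le_trans (hardy_chain p1 l.-1 (nab U) _).
    apply: le_trans h1; rewrite lerD2r -lE.
    under eq_bigr do rewrite rhoE -/(U _).
    rewrite addnC big_split_ord /= lerDl; apply: sumr_ge0 => i _.
    by rewrite mulr_ge0 ?powR_ge0// ltW// hardy_weight_gt0.
  (* Finiteness of the weighted norm allows it to be cancelled from both sides. *)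
  rewrite eqE leeBrDr// -[X in (_ <= X)%E]adde0 leeD2lE; last first.
    rewrite ge0_fin_numE//.
    apply: le_trans (weighted_norm_ge_partial u 0 rho_ge0).
    by rewrite big_ord0.
  rewrite lee_fin /D pmulr_rle0// => pd1.
  by apply/eqP; rewrite eq_le pd1.
have UE m : U m = (rbin (s + l%:R) m)%:C * U 0%N.
  elim: m => [|m IHm]; first by rewrite rbin0 mul1r.
  have := picone_defect_eq0 p1 (defect m.+1); rewrite -lE -/s IHm.
  have g0 : 0 < rbin (s + l%:R) m by rewrite rbin_gt0// ltr_wpDr.
  have gC : (rbin (s + l%:R) m)%:C != 0 by apply/eqP => -[/eqP]; rewrite gt_eqF.
  by move=> h; apply: (mulfI gC); rewrite h; ring.
have U00 : U 0%N = 0.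
  apply: Normc.eq0_normc; apply/eqP; rewrite -/(cabs _) eq_le cabs_ge0 andbT.
  rewrite leNgt; apply/negP => c0.
  have cp0 : 0 < cabs (U 0%N) `^ p by rewrite powR_gt0.
  have [n] := hardy_optimizer_energy_unbounded p1
    (fine (weighted_norm l p rho u) / cabs (U 0%N) `^ p) l0.
  rewrite ltr_pdivrMr// mulr_suml; apply/negP; rewrite -leNgt.
  rewrite -lee_fin fineK; last first.
    rewrite ge0_fin_numE//.
    apply: le_trans (weighted_norm_ge_partial u 0 rho_ge0).
    by rewrite big_ord0.
  apply: le_trans (weighted_norm_ge_partial u n rho_ge0).
  rewrite lee_fin le_eqVlt; apply/orP; left; apply/eqP; apply: eq_bigr => m _.
  have g0 : 0 <= rbin (s + l%:R) m by rewrite rbin_ge0// ltr_wpDr.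
  rewrite rhoE -/(U m) (UE m) -mulrA -powRM ?cabs_ge0//.
  by rewrite cabsM cabs_real ger0_norm.
move=> n; have [nl|] := ltP n l%:Z; first exact: ul.
case: n => // k; rewrite lez_nat => lk; rewrite -(subnKC lk) -/(U _) UE U00.
by rewrite mulr0.
Qed.

Lemma hardy_optimal_near_infinity : optimal_near_infinity l p rho.
Proof.
move=> m eps lm eps0.
have [v [[N vN] vm [B [n [hB Bn]]]]] :=
  hardy_weight_near_infinity p1 (m - l) l0 eps0.
pose u := from_rank (fun m => (v m)%:C).
have uE : (fun m : nat => u (l + m)%:Z) = (fun m => (v m)%:C).
  by apply/funext => i; rewrite /u from_rank_nat.
have uH : H0space m u.
  rewrite -(subnKC lm); apply: from_rank_H0space.
    by exists N => i Ni; rewrite vN.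
  by move=> i im; rewrite vm.
have ul : Hspace l u.
  case: uH => [um _] i il; apply: um; apply: lt_le_trans il _.
  by rewrite lez_nat.
exists u; split => //.
apply: (@le_lt_trans _ _ B%:E).
  apply: energy_le_partial => // k; rewrite uE lee_fin.
  by under eq_bigr do rewrite iter_nab_real cabs_real; exact: hB.
apply: (@lt_le_trans _ _ ((1 + eps) *
    \sum_(m < n) hardy_weight p l m * `|v m| `^ p)%:E).
  by rewrite lte_fin.
rewrite EFinM; apply: lee_wpmul2l; first by rewrite lee_fin addr_ge0// ltW.
apply: le_trans (weighted_norm_ge_partial u n rho_ge0).
rewrite lee_fin le_eqVlt; apply/orP; left; apply/eqP; apply: eq_bigr => i _.
by rewrite rhoE /u from_rank_nat cabs_real.
Qed.

End OptimalWeight.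

Theorem theorem2p11 (R : realType) (l : nat) (p q : R) :
  (0 < l)%N -> 1 < p -> p^-1 + q^-1 = 1 ->
  [/\ forall n : nat, (l <= n)%N ->
        neg_pLaplacian l p (fun k => (gseq l q k)%:C) n%:Z
          / (gseq l q n%:Z `^ (p - 1))%:C
        = (rho_explicit l p q n)%:C,
      optimal_HRB_weight l p (rho_explicit l p q)
    & forall n : nat, (l <= n)%N ->
        pochhammer q^-1 l `^ p / n%:R `^ (l%:R * p) < rho_explicit l p q n].
Proof.
move=> l0 p1 pq; have rhoE := rho_explicitE p1 pq l.
have sq : q^-1 = 1 - p^-1 by rewrite -pq addrC addKr.
have s0 : 0 < 1 - p^-1 by rewrite subr_gt0 invf_lt1// (lt_trans _ p1).
split.
- move=> n ln; rewrite -(subnKC ln); set m := (n - l)%N.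
  set K := Gamma (1 - p^-1) / Gamma 1 * pochhammer (1 - p^-1) l.
  have K0 : 0 < K by rewrite mulr_gt0 ?pochhammer_gt0// divr_gt0 ?Gamma_gt0.
  have gE i : gseq l q (l + i)%:Z = K * rbin (1 - p^-1 + l%:R) i.
    exact: gseq_nat.
  pose u k := (gseq l q k)%:C.
  have ul : Hspace l u by move=> i il; rewrite /u (gseq_lt_rank q il).
  have [h _] := iter_nabla_shift l ul.
  (* The [l]-th difference is the positive real [K * rbin s i], so its signed power is a multiple of
     [hardy_base]. *)
  have F i : spow (p - 1) (iter l (@nabla R) u (l + i)%:Z) =
      (K `^ (p - 1) * hardy_base p i)%:C.
    rewrite h /u.
    under [X in iter l nab X]eq_fun do rewrite gE.
    rewrite iter_nab_real iter_nabZ iter_nab_rbin.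
    have Kr : 0 < K * rbin (1 - p^-1) i by rewrite mulr_gt0 ?rbin_gt0.
    rewrite /spow cabs_real gtr0_norm// -rmorphM.
    rewrite mulr_powRB1 ?(ltW Kr) ?subr_gt0//.
    by rewrite powRM ?(ltW K0) ?rbin_ge0.
  rewrite /neg_pLaplacian (iter_dvg_shift l F) iter_difZ gE rmorphM mulrA.
  (* The sign of the operator cancels the one produced by [l] forward differences. *)
  rewrite rmorphXn rmorphN1 -exprD addnn -mul2n exprM sqrrN expr1n expr1n mul1r.
  rewrite -fmorph_div rhoE; congr (_%:C); rewrite /hardy_weight.
  have g0 : 0 < rbin (1 - p^-1 + l%:R) m by rewrite rbin_gt0// ltr_wpDr.
  rewrite (powRM _ (ltW K0) (ltW g0)).
  by field; rewrite !gt_eqF ?powR_gt0.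
- split.
  + exact: hardy_HRB_weight.
  + exact: hardy_critical.
  + exact: hardy_non_attainable.
  + exact: hardy_optimal_near_infinity.
- move=> n ln; rewrite -(subnKC ln) rhoE sq addnC.
  exact: lt_hardy_weight_powR.
Qed.
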